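(* Let $G$ be an infinite, vertex-transitive graph of finite degree. Let $\nu$ be a probability measure on $\mathbb{N}=\{0,1,2,\dots\}$ such that $\mu=\mu(\nu)<\infty$, where $\mu$ is twice the mean of $\nu$. Then the oil and water dynamics on $G$ started from the product initial configuration determined by $\nu$ fixates almost surely, i.e. \[ \mathbb{P}_\nu\bigl[\text{oil and water fixates}\bigr]=1 . \]
   Context: Oil and water model: there are two types of particles, oils and waters. Initially, at each vertex $x$ of $G$ one places a number of oils and, independently, a number of waters, each distributed according to $\nu$, independently over vertices; thus $\mu$ is the expected total number of particles at a vertex. Each vertex carries an independent rate-$1$ Poisson clock. When the clock of $x$ rings, if $x$ hosts at least one oil and at least one water, then $x$ fires: one oil and one water at $x$ each independently jump to a uniformly chosen neighbor of $x$ (one step of simple random walk); otherwise ($x$ has no particles or only particles of one type) nothing happens. $\mathbb{P}_\nu$ denotes the law of this dynamics. For $x\in V(G)$ and $t\ge0$ let $u_t(x)$ be the number of firings at $x$ up to time $t$. The process fixates if for every finite $A\subset V(G)$ there is a (random) finite time $\tau_A$ such that $u_t(x)=u_{\tau_A}(x)$ for all $x\in A$ and all $t>\tau_A$; otherwise it is active.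
   Formalization: The graph G is additionally assumed to be connected (the usual convention); without this the claim fails, for example for infinitely many disjoint copies of a single edge, where an oil and a water on one edge can jump together forever. *)

(* Defs.v *)
From HB Require Import structures.
From mathcomp Require Import all_boot all_order all_algebra.
From mathcomp Require Import all_classical all_reals all_analysis.
Set Implicit Arguments. Unset Strict Implicit. Unset Printing Implicit Defensive.
Import Order.TTheory GRing.Theory Num.Theory.
Local Open Scope classical_set_scope.
Local Open Scope ring_scope.

(* Graphs: vertex set V (countable), adjacency given by neighbour lists
   (so every vertex has finite degree = size (nbrs x)).                *)
Section Graph.
Variable V : countType.
Variable nbrs : V -> seq V.

Definition adjacent (x y : V) : bool := y \in nbrs x.

Definition simple_graph : Prop :=
  (forall x, uniq (nbrs x)) /\
  (forall x y, (y \in nbrs x) = (x \in nbrs y)) /\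
  (forall x, x \notin nbrs x).

Definition connected_graph : Prop :=
  forall x y : V, exists p : seq V, path adjacent x p && (last x p == y).

Definition infinite_vertex_set : Prop := ~ finite_set [set: V].

Definition vertex_transitive : Prop :=
  forall x y : V, exists phi : V -> V,
    bijective phi /\ phi x = y /\
    forall a b, (b \in nbrs a) = (phi b \in nbrs (phi a)).
End Graph.

Section Nu.
Variable R : realType.
Local Open Scope ereal_scope.
Definition is_prob_on_nat (nu : nat -> R) : Prop :=
  (forall n, (0 <= nu n)%R) /\ \sum_(n <oo) (nu n)%:E = 1.
(* mu(nu) = expected total number of particles at a vertex = 2 * mean *)
Definition mu_of (nu : nat -> R) : \bar R :=
  2%:E * \sum_(n <oo) (n%:R * nu n)%:E.
End Nu.

(* Number of k such that P k holds (P eventually false); 0 otherwise. *)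
Definition cnt (P : nat -> bool) : nat :=
  (\sum_(k < xget 0%N [set N : nat | forall m, (N <= m)%N -> ~~ P m]) (P k : nat))%N.

(* Graphical construction of the oil-and-water dynamics from a fixed
   realisation of the randomness:
   - Oil x, Wat x : initial numbers of oils / waters at x;
   - E x k : k-th interarrival time of the rate-1 Poisson clock at x,
     so the k-th ring of x happens at ring_time x k;
   - ZO x k, ZW x k : neighbours to which the oil / the water jumps if x
     fires at its k-th ring.
   A trajectory is encoded by fires x k = "x fires at its k-th ring".  *)
Section Dynamics.
Variables (R : realType) (V : countType) (nbrs : V -> seq V).
Variables (Oil Wat : V -> nat) (E : V -> nat -> R) (ZO ZW : V -> nat -> V).

Definition ring_time (x : V) (k : nat) : R := \sum_(j < k.+1) E x j.

Section Traj.
Variable fires : V -> nat -> bool.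

Definition fired_before (y : V) (s : R) : nat :=
  cnt (fun k => (ring_time y k < s) && fires y k).

Definition sent_before (Z : V -> nat -> V) (y x : V) (s : R) : nat :=
  cnt (fun k => [&& ring_time y k < s, fires y k & Z y k == x]).

Definition oil_before (x : V) (s : R) : int :=
  (Oil x)%:Z + (\sum_(y <- nbrs x) sent_before ZO y x s)%N%:Z
  - (fired_before x s)%:Z.
Definition wat_before (x : V) (s : R) : int :=
  (Wat x)%:Z + (\sum_(y <- nbrs x) sent_before ZW y x s)%N%:Z
  - (fired_before x s)%:Z.

Definition consistent_traj : Prop :=
  forall x k, fires x k =
    (0 < oil_before x (ring_time x k)) && (0 < wat_before x (ring_time x k)).

Definition u (x : V) (t : R) : nat :=
  cnt (fun k => (ring_time x k <= t) && fires x k).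

Definition fixates : Prop :=
  forall A : set V, finite_set A ->
    exists tau : R, 0 <= tau /\
      forall x, A x -> forall t, tau < t -> u x t = u x tau.
End Traj.
End Dynamics.

Definition mutually_independent (R : realType) (d : measure_display)
  (Omega : measurableType d) (P : probability Omega R) (I : eqType)
  (ev : I -> set (set Omega)) : Prop :=
  forall s : seq I, uniq s -> forall F : I -> set Omega,
    (forall i, i \in s -> ev i (F i)) ->
    P (\bigcap_(i in [set j | j \in s]) F i) = (\prod_(i <- s) P (F i))%E.

Definition rv_index (V : Type) := (V + V + (V * nat) + (V * nat) + (V * nat))%type.

Definition generated_events (R : realType) (V : countType) (d : measure_display)
  (Omega : measurableType d)
  (Oil Wat : V -> Omega -> nat) (E : V -> nat -> Omega -> R)
  (ZO ZW : V -> nat -> Omega -> V) (i : rv_index V) : set (set Omega) :=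
  match i with
  | inl (inl (inl (inl x))) => [set Oil x @^-1` B | B in [set: set nat]]
  | inl (inl (inl (inr x))) => [set Wat x @^-1` B | B in [set: set nat]]
  | inl (inl (inr (x, k))) => [set E x k @^-1` B | B in [set B : set R | measurable B]]
  | inl (inr (x, k)) => [set ZO x k @^-1` B | B in [set: set V]]
  | inr (x, k) => [set ZW x k @^-1` B | B in [set: set V]]
  end.

(* Main.v *)
(* The difference D between the numbers of oils and waters at a site x only
   moves when a neighbour of x fires, and then by a fair step of -1, 0 or 1. So
   D is a martingale, and by Tanaka's formula E|D(t) - m| - E|D(0) - m| is a
   positive multiple of the expected number, up to time t, of firings next to x
   that find D at level m.
   On the other hand transitivity balances the expected flows of particles into
   and out of x, so that E|D(t)| is at most mu for every t.  Hence almost surely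
   every level m is met by finitely many firings next to x, while by Fatou's
   lemma some level is occupied at arbitrarily large integer times.  If the
   neighbours of x fired for ever, the first firing after each of these times
   would meet that level: a contradiction.
   The infinite system is well defined because in a short enough time window
   the sites whose clock rings do not percolate, which excludes infinite
   backward chains of influence.
   Expectations are computed for the truncated counts of firings at ring indices
   smaller than K, which makes every sum finite; K then grows with t. *)
Require Import Defs.
From HB Require Import structures.
From mathcomp Require Import all_boot all_order all_algebra.
From mathcomp Require Import all_classical all_reals all_analysis.
From mathcomp Require Import measurable_realfun.
From mathcomp Require Import zify ring lra.
Import Order.TTheory GRing.Theory Num.Theory.
Import numFieldNormedType.Exports.
Local Open Scope classical_set_scope.
Local Open Scope ring_scope.
Set Implicit Arguments.
Unset Strict Implicit.
Unset Printing Implicit Defensive.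

(** * The configuration space *)

(** The hypotheses give independence only as product formulas for finitely many generating events.
    The law is therefore moved to a canonical space of configurations, where automorphisms act and
    where forgetting coordinates is a map: invariance of the law and independence of a jump from its
    past become statements about preimages. The bound by [mu] rests on a cancellation. A firing at x
    removes one oil and one water, so D is also the difference of the two stocks present at x. Each
    stock is nonnegative and keeps its initial mean, because expected arrivals equal expected
    departures. Truncation at K spoils the sign, since x may send on particles whose arrival was not
    counted. The defect is at most K times the number of neighbours that ring more than K times;
    hence K must grow with t so that K times a power of order K of a number below 1 stays small.
    Tanaka's formula yields a bound only if a firing moves D with positive probability. This needs
    degree at least 2, which infiniteness and connectedness provide. *)

Record config (R : realType) (V : countType) := Config {
  oil : V -> nat; wat : V -> nat; clk : V -> nat -> R;
  zo : V -> nat -> V; zw : V -> nat -> V }.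
Arguments Config {R V}.
Arguments oil {R V}. Arguments wat {R V}. Arguments clk {R V}.
Arguments zo {R V}. Arguments zw {R V}.

Section ConfigSpace.
Variables (R : realType) (V : countType).
Local Notation C := (config R V).

Definition config0 : C :=
  Config (fun _ => 0%N) (fun _ => 0%N) (fun _ _ => 0) (fun x _ => x) (fun x _ => x).

HB.instance Definition _ := gen_eqMixin C.
HB.instance Definition _ := gen_choiceMixin C.
HB.instance Definition _ := isPointed.Build C config0.

Definition iO (x : V) : rv_index V := inl (inl (inl (inl x))).
Definition iW (x : V) : rv_index V := inl (inl (inl (inr x))).
Definition iE (x : V) (k : nat) : rv_index V := inl (inl (inr (x, k))).
Definition iZO (x : V) (k : nat) : rv_index V := inl (inr (x, k)).
Definition iZW (x : V) (k : nat) : rv_index V := inr (x, k).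

Definition atom (i : rv_index V) : set (set C) :=
  match i with
  | inl (inl (inl (inl x))) => range (fun n => [set c : C | oil c x = n])
  | inl (inl (inl (inr x))) => range (fun n => [set c : C | wat c x = n])
  | inl (inl (inr (x, k))) => range (fun r => [set c : C | clk c x k <= r])
  | inl (inr (x, k)) => range (fun y => [set c : C | zo c x k = y])
  | inr (x, k) => range (fun y => [set c : C | zw c x k = y])
  end.

(** The two trivial sets make each family stable under intersection: distinct values of a discrete
    coordinate exclude each other, and [setT] stands for a coordinate left free. *)
Definition gen (i : rv_index V) : set (set C) :=
  [set S | [\/ S = set0, S = setT | atom i S]].

Definition cylinder : set (set C) :=
  [set S | exists s F, [/\ uniq s, forall i, gen i (F i) &
     S = \bigcap_(i in [set j | j \in s]) F i]].

HB.instance Definition _ := @isMeasurable.Build (sigma_display cylinder) C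
  <<s cylinder >> (@sigma_algebra0 _ setT cylinder) (@sigma_algebraC _ cylinder)
  (@sigma_algebra_bigcup _ setT cylinder).

Lemma genI i A B : gen i A -> gen i B -> gen i (A `&` B).
Proof.
have disj (T : Type) (U : eqType) (f : T -> U) (a b : U) :
    [set c | f c = a] `&` [set c | f c = b] = set0 \/
    [set c | f c = a] `&` [set c | f c = b] = [set c | f c = a].
  have [<-|nab] := eqVneq a b; [right|left].
    by rewrite setIid.
  by apply/seteqP; split=> c //= -[-> /eqP]; rewrite (negbTE nab).
move=> [->|->|hA] [->|->|hB]; rewrite ?set0I ?setI0 ?setTI ?setIT;
  try by [left|right; left|apply: Or33|apply: Or32|apply: Or31].
case: i hA hB => [[[[x|x]|[x k]]|[x k]]|[x k]] /= [a _ <-] [b _ <-].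
- by have [->|->] := disj _ _ (fun c : C => oil c x) a b; [apply: Or31|apply: Or33; exists a].
- by have [->|->] := disj _ _ (fun c : C => wat c x) a b; [apply: Or31|apply: Or33; exists a].
- apply: Or33; exists (Num.min a b) => //; apply/seteqP; split=> c /=.
    by rewrite le_min => /andP.
  by move=> [? ?]; rewrite le_min; apply/andP.
- by have [->|->] := disj _ _ (fun c : C => zo c x k) a b; [apply: Or31|apply: Or33; exists a].
- by have [->|->] := disj _ _ (fun c : C => zw c x k) a b; [apply: Or31|apply: Or33; exists a].
Qed.

Lemma genT i : gen i setT. Proof. exact: Or32. Qed.

Lemma cylinderT : cylinder setT.
Proof.
exists [::], (fun=> setT); split=> //; first by move=> i; exact: genT.
by apply/seteqP; split.
Qed.

(** Serves to write two cylinders over a common list of coordinates. *)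
Lemma bigcap_extend (T : Type) (s r : seq (rv_index V)) (F : rv_index V -> set T) :
  {subset s <= r} ->
  \bigcap_(i in [set j | j \in s]) F i =
  \bigcap_(i in [set j | j \in r]) (if i \in s then F i else setT).
Proof.
move=> sr; apply/seteqP; split=> c h i /= hi.
  by case: ifP => // si; apply: h.
by have := h i (sr _ hi); rewrite hi.
Qed.

Lemma cylinderI : setI_closed cylinder.
Proof.
move=> A B [s [F [us hF ->]]] [s' [F' [us' hF' ->]]].
pose r := undup (s ++ s').
exists r, (fun i => (if i \in s then F i else setT) `&` (if i \in s' then F' i else setT)).
split; first exact: undup_uniq.
  by move=> i; apply: genI; case: ifP => _ //; exact: genT.
rewrite (@bigcap_extend _ s r); last by move=> i si; rewrite mem_undup mem_cat si.
rewrite (@bigcap_extend _ s' r); last by move=> i si; rewrite mem_undup mem_cat si orbT.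
by rewrite bigcapI.
Qed.

Lemma measurable_cylinder A : cylinder A -> measurable A.
Proof. exact: sub_sigma_algebra. Qed.

Lemma measurable_gen i A : gen i A -> measurable A.
Proof.
move=> h; apply: measurable_cylinder; exists [:: i], (fun j => if j == i then A else setT).
split=> //; first by move=> j; case: eqP => [->//|_]; exact: genT.
apply/seteqP; split=> [c hc j /=|c hc].
  by rewrite inE => /eqP ->; rewrite eqxx.
by have := hc i; rewrite eqxx; apply; rewrite /= mem_head.
Qed.

Lemma measurable_atom i A : atom i A -> measurable A.
Proof. by move=> h; apply: (@measurable_gen i); apply: Or33. Qed.

Lemma measurable_config d (T : measurableType d) (f : T -> C) :
  (forall i A, atom i A -> measurable (f @^-1` A)) -> measurable_fun setT f.
Proof.
move=> h; apply: (measurability cylinder) => //.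
move=> _ [B [s [F [us hF ->]]] <-]; rewrite setTI.
rewrite preimage_bigcap; apply: fin_bigcap_measurable.
  exact: finite_seq.
move=> i _; case: (hF i) => [->|->|/h //]; rewrite ?preimage_set0 ?preimage_setT //.
Qed.
End ConfigSpace.

(** * Independence of complementary blocks of coordinates *)

Section BlockIndependence.
Variables (R : realType) (V : countType).
Local Notation C := (config R V).
Local Notation I := (rv_index V).

Definition keep (J : pred I) (c : C) : C :=
  Config (fun x => if J (iO x) then oil c x else 0%N)
         (fun x => if J (iW x) then wat c x else 0%N)
         (fun x k => if J (iE x k) then clk c x k else 0)
         (fun x k => if J (iZO x k) then zo c x k else x)
         (fun x k => if J (iZW x k) then zw c x k else x).

Lemma keep_gen (J : pred I) i (A : set C) : gen i A ->
  (J i /\ keep J @^-1` A = A) \/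
  (~~ J i /\ (keep J @^-1` A = set0 \/ keep J @^-1` A = setT)).
Proof.
have constant (P : Prop) : [set c : C | P] = set0 \/ [set c : C | P] = setT.
  by have [p|np] := pselect P; [right|left]; apply/seteqP; split=> c.
case=> [->|->|]; rewrite ?preimage_set0 ?preimage_setT;
  try by case: (boolP (J i)) => _; [left|right; split=> //; by [left|right]].
case: i => [[[[x|x]|[x k]]|[x k]]|[x k]] /= [a _ <-]; rewrite /preimage /= /iO /iW /iE /iZO /iZW;
  by case: (J _); [left|right; split=> //; exact: constant].
Qed.

Lemma gen_keep (J : pred I) i (A : set C) : gen i A -> gen i (keep J @^-1` A).
Proof.
by move=> gA; case: (keep_gen J gA) => [[_ ->]//|[_ [->|->]]]; [exact: Or31|exact: Or32].
Qed.

Lemma measurable_keep J : measurable_fun setT (keep J).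
Proof.
by apply: measurable_config => i A hA; apply: (@measurable_gen _ _ i); apply: gen_keep; apply: Or33.
Qed.

Lemma measurable_preimage_keep (J : pred I) (A : set C) : measurable A -> measurable (keep J @^-1` A).
Proof. by move=> mA; rewrite -[X in measurable X]setTI; exact: measurable_keep. Qed.

Variable Q : probability C R.

Definition independent_coordinates := forall s, uniq s -> forall F, (forall i, gen i (F i)) ->
  Q (\bigcap_(i in [set j | j \in s]) F i) = (\prod_(i <- s) Q (F i))%E.
Hypothesis Qind : independent_coordinates.

Lemma cylinder_ext (m1 m2 : {measure set C -> \bar R}) :
  (m1 setT < +oo)%E -> (forall S, cylinder S -> m1 S = m2 S) ->
  forall S, measurable S -> m1 S = m2 S.
Proof.
move=> fin h S mS.
apply: (g_sigma_algebra_measure_unique (@cylinder R V) _ (fun=> setT)) => //.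
- exact: measurable_cylinder.
- by move=> _; exact: cylinderT.
- by rewrite bigcup_const//; exists 0%N.
- exact: cylinderI.
Qed.

Lemma Qfin A : measurable A -> Q A \is a fin_num.
Proof. by move=> mA; apply: fin_num_measure. Qed.

(** Independence plays no part yet: the coordinate [i] lies in only one of the two blocks, so one of
    the two preimages is empty or everything. *)
Lemma block_gen (J : pred I) i (A B : set C) : gen i A -> gen i B ->
  (Q (keep J @^-1` A `&` keep (predC J) @^-1` B) =
  Q (keep J @^-1` A) * Q (keep (predC J) @^-1` B))%E.
Proof.
move=> gA gB; case: (keep_gen J gA) => [[Ji ->]|[_ [->|->]]].
- case: (keep_gen (predC J) gB) => [[] /=|[_ [->|->]]]; first by rewrite Ji.
    by rewrite setI0 measure0 mule0.
  by rewrite setIT probability_setT mule1.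
- by rewrite set0I measure0 mul0e.
- by rewrite setTI probability_setT mul1e.
Qed.

Lemma block_cylinder (J : pred I) (A B : set C) : cylinder A -> cylinder B ->
  (Q (keep J @^-1` A `&` keep (predC J) @^-1` B) =
  Q (keep J @^-1` A) * Q (keep (predC J) @^-1` B))%E.
Proof.
move=> [s [F [us hF ->]]] [s' [F' [us' hF' ->]]].
pose r := undup (s ++ s'); have ur : uniq r by exact: undup_uniq.
rewrite (@bigcap_extend _ _ s r); last by move=> i si; rewrite mem_undup mem_cat si.
rewrite (@bigcap_extend _ _ s' r); last by move=> i si; rewrite mem_undup mem_cat si orbT.
set G := fun i => if i \in s then F i else setT.
set G' := fun i => if i \in s' then F' i else setT.
have hG i : gen i (G i) by rewrite /G; case: ifP => _ //; exact: genT.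
have hG' i : gen i (G' i) by rewrite /G'; case: ifP => _ //; exact: genT.
rewrite !preimage_bigcap -bigcapI !Qind//; last first.
- by move=> i; apply: genI; exact: gen_keep.
- by move=> i; exact: gen_keep.
- by move=> i; exact: gen_keep.
rewrite -big_split /=; apply: eq_bigr => i _; exact: (block_gen J (hG i) (hG' i)).
Qed.


Lemma block_independence (J : pred I) (A B : set C) : measurable A -> measurable B ->
  (Q (keep J @^-1` A `&` keep (predC J) @^-1` B) =
  Q (keep J @^-1` A) * Q (keep (predC J) @^-1` B))%E.
Proof.
(* Extension from cylinders to measurable sets in one factor, to be applied to each factor in turn:
   for fixed [D] both sides are finite measures of [S], and cylinders form a pi-system. *)
have step K D (mD : measurable D) :
    (forall S, cylinder S -> Q (keep K @^-1` S `&` D) = Q (keep K @^-1` S) * Q D)%E ->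
    forall S, measurable S -> (Q (keep K @^-1` S `&` D) = Q (keep K @^-1` S) * Q D)%E.
  move=> h S mS.
  have mk := measurable_keep K.
  have q0 : (0 <= fine (Q D))%R by apply: fine_ge0.
  pose push := @measure_function_pushforward__canonical__measure_function_Measure _ _ C C R.
  pose m1 : {measure set C -> \bar R} := push (mrestr Q mD) (keep K) mk.
  pose m2 : {measure set C -> \bar R} := mscale (NngNum q0) (push Q (keep K) mk).
  suff -> : (Q (keep K @^-1` S `&` D) = m2 S).
    change ((fine (Q D))%:E * Q (keep K @^-1` S) = Q (keep K @^-1` S) * Q D)%E.
    by rewrite fineK ?Qfin// muleC.
  have -> : (Q (keep K @^-1` S `&` D) = m1 S) by [].
  apply: cylinder_ext => //.
    change (Q (keep K @^-1` setT `&` D) < +oo)%E; rewrite preimage_setT setTI.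
    by rewrite (le_lt_trans (probability_le1 Q mD))// ltry.
  move=> S' cS'.
  change (Q (keep K @^-1` S' `&` D) = (fine (Q D))%:E * Q (keep K @^-1` S'))%E.
  by rewrite h// fineK ?Qfin// muleC.
move=> mA mB.
apply: (step) => //; first exact: measurable_preimage_keep.
move=> A' cA'; rewrite setIC muleC; apply: (step) => //.
  by apply: measurable_preimage_keep; exact: measurable_cylinder.
by move=> B' cB'; rewrite setIC muleC; exact: block_cylinder.
Qed.

Lemma independent_blocks (J : pred I) (A B : set C) : measurable A -> measurable B ->
  keep J @^-1` A = A -> keep (predC J) @^-1` B = B -> (Q (A `&` B) = Q A * Q B)%E.
Proof. by move=> mA mB eA eB; rewrite -{1}eA -{1}eB block_independence// eA eB. Qed.
End BlockIndependence.

(** * The dynamics as a measurable function *)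

Section DiscreteMeasurability.
Context d (T : measurableType d).
Implicit Types (b : T -> bool) (f : T -> nat).

Lemma measurable_fun_discrete d' (U : measurableType d') (g : nat -> U) f :
  measurable_fun setT f -> measurable_fun setT (fun c => g (f c)).
Proof. by move=> mf; apply: (measurableT_comp (f := g)) => // _ Y _. Qed.

Lemma measurable_fun_discrete2 d' (U : measurableType d') (g : nat -> nat -> U) f f' :
  measurable_fun setT f -> measurable_fun setT f' ->
  measurable_fun setT (fun c => g (f c) (f' c)).
Proof.
move=> mf mf' _ Y mY; rewrite setTI.
have -> : (fun c => g (f c) (f' c)) @^-1` Y =
    \bigcup_i (f @^-1` [set i] `&` f' @^-1` [set j | Y (g i j)]).
  apply/seteqP; split=> c /=; first by move=> h; exists (f c).
  by move=> [i _ [/= <-]].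
apply: bigcup_measurable => i _; apply: measurableI; rewrite -[X in measurable X]setTI.
  exact: mf.
exact: mf'.
Qed.

Lemma measurable_fun_nat_of_bool b :
  measurable_fun setT b -> measurable_fun setT (fun c => b c : nat).
Proof. by move=> mf; apply: (measurableT_comp (f := nat_of_bool)) => // _ Y _. Qed.

Lemma measurable_fun_sumn (I : Type) (s : seq I) (f : I -> T -> nat) :
  (forall i, measurable_fun setT (f i)) ->
  measurable_fun setT (fun c => \sum_(i <- s) f i c)%N.
Proof.
move=> mf; elim: s => [|i s ih].
  by under eq_fun do rewrite big_nil; exact: measurable_cst.
by under eq_fun do rewrite big_cons; exact: (measurable_fun_discrete2 addn).
Qed.

Lemma measurable_set_bool b : measurable_fun setT b -> measurable [set c | b c].
Proof.
move=> mb; rewrite (_ : [set c | b c] = setT `&` b @^-1` [set true]).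
  by apply: mb.
by rewrite setTI.
Qed.

Lemma measurable_bool_set b : measurable [set c | b c] -> measurable_fun setT b.
Proof. by move=> mb; apply: (measurable_fun_bool true); rewrite setTI. Qed.
End DiscreteMeasurability.

Section Dynamics.
Variables (R : realType) (V : countType) (nbrs : V -> seq V).
Local Notation C := (config R V).
Implicit Types (c : C) (x y : V) (k j n : nat).

Definition rt c x k : R := ring_time (clk c) x k.

(* Truncated at depth [m], where only the first [m] rings of each clock are looked
   at, the dynamics is a finite computation; it stabilises as [m] grows. *)
Fixpoint fires_upto n c x k : bool :=
  if n isn't m.+1 then false else
  let before y j := (rt c y j < rt c x k) && fires_upto m c y j in
  let fired := (\sum_(j < m) before x j)%N in
  (fired < oil c x + \sum_(y <- nbrs x) \sum_(j < m) (before y j && (zo c y j == x)))%N &&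
  (fired < wat c x + \sum_(y <- nbrs x) \sum_(j < m) (before y j && (zw c y j == x)))%N.

(** The eventual value, false where the computation does not settle on true. This makes [fires]
    measurable on the whole space; stabilisation is proved on good configurations. *)
Definition fires c x k : bool :=
  `[< exists N, forall n, (N <= n)%N -> fires_upto n c x k >].

Lemma measurable_clk x k : measurable_fun setT (fun c => clk c x k).
Proof.
apply: (measurability _ (RGenOInfty.measurableE R)) => //.
move=> _ [_ [a ->] <-]; rewrite setTI.
rewrite (_ : _ @^-1` _ = ~` [set c | clk c x k <= a]).
  by apply: measurableC; apply: (@measurable_atom _ _ (iE x k)); exists a.
by apply/seteqP; split=> c /=; rewrite in_itv/= andbT ltNge; move/negP.
Qed.

Lemma measurable_oil x : measurable_fun setT (fun c => oil c x).
Proof.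
move=> _ Y _; rewrite setTI.
rewrite (_ : _ @^-1` Y = \bigcup_(n in Y) [set c : C | oil c x = n]).
  apply: bigcup_measurable => n _.
  by apply: (@measurable_atom _ _ (iO x)); exists n.
by apply/seteqP; split=> c /=; [move=> h; exists (oil c x)|move=> [n /= ? ->]].
Qed.

Lemma measurable_wat x : measurable_fun setT (fun c => wat c x).
Proof.
move=> _ Y _; rewrite setTI.
rewrite (_ : _ @^-1` Y = \bigcup_(n in Y) [set c : C | wat c x = n]).
  apply: bigcup_measurable => n _.
  by apply: (@measurable_atom _ _ (iW x)); exists n.
by apply/seteqP; split=> c /=; [move=> h; exists (wat c x)|move=> [n /= ? ->]].
Qed.

Lemma measurable_zo x k y : measurable_fun setT (fun c => zo c x k == y).
Proof.
apply: measurable_bool_set; rewrite (_ : [set c | _] = [set c | zo c x k = y]).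
  by apply: (@measurable_atom _ _ (iZO x k)); exists y.
by apply/seteqP; split=> c /= /eqP.
Qed.

Lemma measurable_zw x k y : measurable_fun setT (fun c => zw c x k == y).
Proof.
apply: measurable_bool_set; rewrite (_ : [set c | _] = [set c | zw c x k = y]).
  by apply: (@measurable_atom _ _ (iZW x k)); exists y.
by apply/seteqP; split=> c /= /eqP.
Qed.

Lemma rt_mono c x j k : (forall i, 0 < clk c x i) -> (j <= k)%N -> rt c x j <= rt c x k.
Proof.
move=> pos jk; rewrite /rt /ring_time -!(big_mkord predT (clk c x)).
rewrite [leRHS](big_cat_nat (n := j.+1)) //= lerDl.
by apply: sumr_ge0 => i _; exact: ltW.
Qed.

Lemma measurable_rt x k : measurable_fun setT (fun c => rt c x k).
Proof. by apply: measurable_sum => j; exact: measurable_clk. Qed.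

Lemma measurable_fires_upto n x k : measurable_fun setT (fun c => fires_upto n c x k).
Proof.
elim: n x k => [|m ih] x k /=; first exact: measurable_cst.
have mb y j : measurable_fun setT (fun c => (rt c y j < rt c x k) && fires_upto m c y j).
  by apply: measurable_and => //; apply: measurable_fun_ltr; exact: measurable_rt.
by apply: measurable_and; (apply: (measurable_fun_discrete2 (fun a b => (a < b)%N));
  [|apply: (measurable_fun_discrete2 addn); [by [exact: measurable_oil|exact: measurable_wat]|]]);
  apply: measurable_fun_sumn => y; try apply: measurable_fun_sumn => j;
  apply: measurable_fun_nat_of_bool => //; apply: measurable_and => //;
  by [exact: measurable_zo|exact: measurable_zw].
Qed.

Lemma measurable_fires x k : measurable_fun setT (fun c => fires c x k).
Proof.
apply: measurable_bool_set.
rewrite (_ : [set c | _] = \bigcup_N \bigcap_(n in [set n | (N <= n)%N])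
    [set c | fires_upto n c x k]).
  apply: bigcup_measurable => N _; apply: bigcap_measurable; first by exists N => /=.
  by move=> n _; apply: measurable_set_bool; exact: measurable_fires_upto.
by apply/seteqP; split=> c /=; [move/asboolP => [N h]; exists N|move=> [N _ h]; apply/asboolP; exists N].
Qed.
End Dynamics.

Lemma cntE (A : nat -> bool) N M : (forall m, (N <= m)%N -> ~~ A m) -> (N <= M)%N ->
  cnt A = (\sum_(k < M) A k)%N.
Proof.
move=> hN NM.
have sumE a b : (a <= b)%N -> (forall m, (a <= m)%N -> ~~ A m) ->
    (\sum_(k < a) A k = \sum_(k < b) A k)%N.
  move=> ab ha; rewrite -!(big_mkord predT (fun k => A k : nat)) (big_cat_nat (n := a) _ ab) //=.
  by rewrite [X in _ = (_ + X)%N]big_nat_cond [X in _ = (_ + X)%N]big1 ?addn0// => i /andP[/andP[/ha/negbTE -> _] _].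
rewrite /cnt; set N0 := xget _ _.
have hN0 : forall m, (N0 <= m)%N -> ~~ A m.
  by rewrite /N0; case: xgetP => [x _ //|/(_ N) h]; case: h.
rewrite (sumE N0 (maxn N0 M)) ?leq_maxl//.
by rewrite (sumE M (maxn N0 M)) ?leq_maxr// => m /(leq_trans NM); exact: hN.
Qed.

(** * Existence and uniqueness of the trajectory of a good configuration *)

Section GoodConfigurations.
Variables (R : realType) (V : countType) (nbrs : V -> seq V).
Local Notation C := (config R V).
Variable c : C.
Implicit Types (x y : V) (k j n : nat).

(** The events from which the outcome of [e] is computed. The inequality is strict because
    [consistent_traj] reads the state strictly before a ring. *)
Definition precedes (e' e : V * nat) : Prop :=
  (e'.1 \in e.1 :: nbrs e.1) /\ rt c e'.1 e'.2 < rt c e.1 e.2.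

Definition good : Prop :=
  [/\ forall x k, 0 < clk c x k,
      forall x (t : R), exists k, t < rt c x k
    & well_founded precedes].

Hypothesis c_good : good.

Lemma rt_lt x j k : (j < k)%N -> rt c x j < rt c x k.
Proof.
have [hpos _ _] := c_good => jk; rewrite /rt /ring_time.
rewrite -!(big_mkord predT (clk c x)) (@big_cat_nat _ _ _ j.+1 0 k.+1) //=; last exact: ltnW.
rewrite ltrDl big_nat_recr//= ltr_wpDl //.
by apply: sumr_ge0 => i _; exact: ltW.
Qed.

Lemma rt_le x j k : (j <= k)%N -> rt c x j <= rt c x k.
Proof. by have [pos _ _] := c_good; exact: rt_mono. Qed.

Lemma rings_bounded x (t : R) : exists N, forall k, (N <= k)%N -> t < rt c x k.
Proof.
have [_ hfin _] := c_good; have [N hN] := hfin x t.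
by exists N => k /(rt_le x); exact: lt_le_trans.
Qed.

Lemma rings_boundedP : exists L : V -> R -> nat,
  forall x t k, (L x t <= k)%N -> t < rt c x k.
Proof.
have [L hL] := @choice _ _ (fun (e : V * R) N => forall k, (N <= k)%N -> e.2 < rt c e.1 k)
  (fun e => rings_bounded e.1 e.2).
by exists (fun x t => L (x, t)) => x t k; exact: (hL (x, t)).
Qed.

Definition can_fire (f : V -> nat -> bool) x k : bool :=
  (0 < oil_before nbrs (oil c) (clk c) (zo c) f x (rt c x k)) &&
  (0 < wat_before nbrs (wat c) (clk c) (zw c) f x (rt c x k)).

Lemma can_fire_eq (f g : V -> nat -> bool) x k :
  (forall y j, precedes (y, j) (x, k) -> f y j = g y j) -> can_fire f x k = can_fire g x k.
Proof.
move=> h.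
have hb y j : y \in x :: nbrs x ->
    (rt c y j < rt c x k) && f y j = (rt c y j < rt c x k) && g y j.
  by move=> hy; case: (boolP (rt c y j < rt c x k)) => // hlt; apply: h.
have hf : fired_before (clk c) f x (rt c x k) = fired_before (clk c) g x (rt c x k).
  by congr cnt; apply/funext => j; apply: hb; rewrite mem_head.
have hs Z : (\sum_(y <- nbrs x) sent_before (clk c) f Z y x (rt c x k) =
    \sum_(y <- nbrs x) sent_before (clk c) g Z y x (rt c x k))%N.
  rewrite big_seq [RHS]big_seq; apply: eq_bigr => y hy; congr cnt; apply/funext => j.
  by rewrite !andbA hb// inE hy orbT.
by rewrite /can_fire /oil_before /wat_before hf !hs.
Qed.

(** Once [m] exceeds the indices of all relevant earlier rings, the counts are finite sums and the
    condition takes the form of one unfolding of [fires_upto]. *)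
Lemma can_fireE (L : nat) (f : V -> nat -> bool) x k m :
  (forall y j, y \in x :: nbrs x -> (L <= j)%N -> rt c x k < rt c y j) -> (L <= m)%N ->
  let before y j := (rt c y j < rt c x k) && f y j in
  let fired := (\sum_(j < m) before x j)%N in
  can_fire f x k =
  (fired < oil c x + \sum_(y <- nbrs x) \sum_(j < m) (before y j && (zo c y j == x)))%N &&
  (fired < wat c x + \sum_(y <- nbrs x) \sum_(j < m) (before y j && (zw c y j == x)))%N.
Proof.
move=> hL Lm before fired.
have hf : fired_before (clk c) f x (rt c x k) = fired.
  rewrite /fired_before (@cntE _ L m)// => j Lj.
  by rewrite negb_and -leNgt ltW//; apply: hL => //; exact: mem_head.
have hs Z : (\sum_(y <- nbrs x) sent_before (clk c) f Z y x (rt c x k) =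
    \sum_(y <- nbrs x) \sum_(j < m) (before y j && (Z y j == x)))%N.
  rewrite big_seq [RHS]big_seq; apply: eq_bigr => y hy.
  rewrite /sent_before (@cntE _ L m)//; last first.
    by move=> j Lj; rewrite negb_and -leNgt ltW//; apply: hL => //; rewrite inE hy orbT.
  by apply: eq_bigr => j _; rewrite /before -andbA.
by rewrite /can_fire /oil_before /wat_before hf !hs !subr_gt0 -!PoszD !ltz_nat.
Qed.

(** Both claims go through one well-founded induction: stabilisation at the finitely many preceding
    events gives a depth from which the recursion at [e] computes the true condition. *)
Lemma fires_spec e : fires nbrs c e.1 e.2 = can_fire (fires nbrs c) e.1 e.2 /\
  exists N, forall n, (N <= n)%N -> fires_upto nbrs n c e.1 e.2 = fires nbrs c e.1 e.2.
Proof.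
have [_ _ wf] := c_good; elim/(well_founded_ind wf): e => -[x k] ih /=.
have [Nf hNf] : exists Nf : V * nat -> nat, forall e', precedes e' (x, k) ->
    forall n, (Nf e' <= n)%N -> fires_upto nbrs n c e'.1 e'.2 = fires nbrs c e'.1 e'.2.
  have [e'|Nf h] := @choice _ _ (fun e' N => precedes e' (x, k) -> forall n, (N <= n)%N ->
    fires_upto nbrs n c e'.1 e'.2 = fires nbrs c e'.1 e'.2); last by exists Nf.
  have [he|he] := pselect (precedes e' (x, k)); last by exists 0%N.
  by have [_ [N hN]] := ih _ he; exists N.
have [L hL] := rings_boundedP.
pose l y := L y (rt c x k).
(* A sum in place of a maximum: [M] dominates every index bound [l y] and every stabilisation depth
   of a preceding event. *)
pose M := (\sum_(y <- x :: nbrs x) (l y + \sum_(j < l y) Nf (y, nat_of_ord j)))%N.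
have le_sum (F : V -> nat) y : y \in x :: nbrs x -> (F y <= \sum_(z <- x :: nbrs x) F z)%N.
  by move=> hy; rewrite (big_rem y)//= leq_addr.
have lM y : y \in x :: nbrs x -> (l y <= M)%N.
  by move=> hy; rewrite (leq_trans _ (le_sum _ _ hy))// leq_addr.
have hlt y j : y \in x :: nbrs x -> (M <= j)%N -> rt c x k < rt c y j.
  by move=> hy Mj; apply: hL; apply: leq_trans Mj; exact: lM.
have hM m : (M <= m)%N -> fires_upto nbrs m.+1 c x k = can_fire (fires nbrs c) x k.
  move=> Mm; rewrite (can_fireE _ hlt Mm) /=.
  have hb y j : y \in x :: nbrs x -> (rt c y j < rt c x k) && fires_upto nbrs m c y j =
      (rt c y j < rt c x k) && fires nbrs c y j.
    move=> hy; case: (boolP (rt c y j < rt c x k)) => //= hj.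
    apply: (hNf (y, j)) => //.
    have jl : (j < l y)%N by rewrite ltnNge; apply/negP => /hL; rewrite ltNge (ltW hj).
    apply: leq_trans Mm; apply: leq_trans (le_sum _ _ hy).
    rewrite (leq_trans _ (leq_addl _ _))//.
    by rewrite (bigD1 (Ordinal jl))//= leq_addr.
  have hs (A B : V -> nat -> bool) : (forall y j, y \in x :: nbrs x -> A y j = B y j) ->
      (\sum_(y <- nbrs x) \sum_(j < m) A y j = \sum_(y <- nbrs x) \sum_(j < m) B y j)%N.
    move=> hAB; rewrite big_seq [RHS]big_seq; apply: eq_bigr => y hy.
    by apply: eq_bigr => j _; rewrite hAB// inE hy orbT.
  have hb0 : (\sum_(j < m) ((rt c x j < rt c x k)%R && fires_upto nbrs m c x j) =
     \sum_(j < m) ((rt c x j < rt c x k)%R && fires nbrs c x j))%N.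
    by apply: eq_bigr => j _; rewrite hb// mem_head.
  rewrite hb0 (hs (fun y j => ((rt c y j < rt c x k) && fires_upto nbrs m c y j) && (zo c y j == x))
    (fun y j => ((rt c y j < rt c x k) && fires nbrs c y j) && (zo c y j == x))); last first.
    by move=> y j hy; rewrite hb.
  rewrite (hs (fun y j => ((rt c y j < rt c x k) && fires_upto nbrs m c y j) && (zw c y j == x))
    (fun y j => ((rt c y j < rt c x k) && fires nbrs c y j) && (zw c y j == x))) //.
  by move=> y j hy; rewrite hb.
have hE : fires nbrs c x k = can_fire (fires nbrs c) x k.
  rewrite {1}/fires; case: (boolP (can_fire _ x k)) => hc.
    by apply/asboolP; exists M.+1 => -[//|m]; rewrite ltnS => /hM ->.
  apply/asboolP => -[N /(_ (maxn N M).+1)].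
  by rewrite hM ?leq_maxr// (negbTE hc) => h; have := h (leqW (leq_maxl _ _)).
by split=> //; exists M.+1 => -[//|m]; rewrite ltnS hE; exact: hM.
Qed.

Lemma fires_consistent :
  consistent_traj nbrs (oil c) (wat c) (clk c) (zo c) (zw c) (fires nbrs c).
Proof. by move=> x k; have [-> _] := fires_spec (x, k). Qed.

Lemma consistent_unique f :
  consistent_traj nbrs (oil c) (wat c) (clk c) (zo c) (zw c) f -> f = fires nbrs c.
Proof.
move=> hf; have [_ _ wf] := c_good.
suff h e : f e.1 e.2 = fires nbrs c e.1 e.2 by apply/funext => x; apply/funext => k; exact: (h (x, k)).
elim/(well_founded_ind wf): e => -[x k] ih /=.
have [-> _] := fires_spec (x, k); rewrite /= -(can_fire_eq (f := f)); first exact: hf.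
by move=> y j; exact: ih.
Qed.
End GoodConfigurations.

(** * Invariance under automorphisms *)

Section Law.
Variables (R : realType) (V : countType) (nbrs : V -> seq V) (nu : nat -> R).
Local Notation C := (config R V).

Record oil_water_law (Q : probability C R) : Prop := OilWaterLaw {
  law_indep : independent_coordinates Q;
  law_oil : forall x n, Q [set c | oil c x = n] = (nu n)%:E;
  law_wat : forall x n, Q [set c | wat c x = n] = (nu n)%:E;
  law_clk : forall x k r,
    Q [set c | clk c x k <= r] = (if 0 <= r then 1 - expR (- r) else 0)%:E;
  law_zo : forall x k y,
    Q [set c | zo c x k = y] = (if y \in nbrs x then (size (nbrs x))%:R^-1 else 0)%:E;
  law_zw : forall x k y,
    Q [set c | zw c x k = y] = (if y \in nbrs x then (size (nbrs x))%:R^-1 else 0)%:E }.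

Hypothesis nbrs_uniq : forall x, uniq (nbrs x).
Variables (phi psi : V -> V).
Hypotheses (phiK : cancel phi psi) (psiK : cancel psi phi).
Hypothesis phi_adj : forall a b, (b \in nbrs a) = (phi b \in nbrs (phi a)).

Lemma nbrs_perm x : perm_eq (map phi (nbrs x)) (nbrs (phi x)).
Proof.
apply: uniq_perm; rewrite ?map_inj_uniq//; first exact: can_inj phiK.
by move=> y; rewrite -[y]psiK mem_map -?phi_adj//; exact: can_inj phiK.
Qed.

Lemma size_nbrs_phi x : size (nbrs (phi x)) = size (nbrs x).
Proof. by rewrite -(perm_size (nbrs_perm x)) size_map. Qed.

(** Relabelling by the automorphism: [x] receives the data of [phi x], so the jump targets have to
    be brought back by [psi]. *)
Definition pull (c : C) : C :=
  Config (fun x => oil c (phi x)) (fun x => wat c (phi x)) (fun x k => clk c (phi x) k)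
    (fun x k => psi (zo c (phi x) k)) (fun x k => psi (zw c (phi x) k)).

Lemma psi_eq a x : (psi a == x) = (a == phi x).
Proof. by rewrite (can2_eq psiK phiK). Qed.

Lemma fires_upto_pull n c x k : fires_upto nbrs n (pull c) x k = fires_upto nbrs n c (phi x) k.
Proof.
elim: n x k => [//|m ih] x k /=.
have rtE y j : rt (pull c) y j = rt c (phi y) j by [].
rewrite -!(perm_big _ (nbrs_perm x)) /= !big_map.
by congr andb; congr (_ < _ + _)%N; do ?(apply: eq_bigr => ? _); rewrite ?ih ?rtE ?psi_eq.
Qed.

Lemma fires_pull c x k : fires nbrs (pull c) x k = fires nbrs c (phi x) k.
Proof.
rewrite /fires; congr asbool; apply/propext; split=> -[N h]; exists N => n /h.
  by rewrite fires_upto_pull.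
by rewrite fires_upto_pull.
Qed.

Definition index_map (f : V -> V) (i : rv_index V) : rv_index V :=
  match i with
  | inl (inl (inl (inl x))) => iO (f x)
  | inl (inl (inl (inr x))) => iW (f x)
  | inl (inl (inr (x, k))) => iE (f x) k
  | inl (inr (x, k)) => iZO (f x) k
  | inr (x, k) => iZW (f x) k
  end.

Lemma index_mapK f g : cancel f g -> cancel (index_map f) (index_map g).
Proof. by move=> h [[[[x|x]|[x k]]|[x k]]|[x k]] /=; rewrite /iO /iW /iE /iZO /iZW h. Qed.

Lemma atom_pull i A : atom i A -> atom (index_map phi i) (pull @^-1` A).
Proof.
case: i => [[[[x|x]|[x k]]|[x k]]|[x k]] /= [a _ <-]; [by exists a|by exists a|by exists a| |];
  exists (phi a) => //; apply/seteqP; split=> c /=.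
- by move=> ->; rewrite phiK.
- by move=> <-; rewrite psiK.
- by move=> ->; rewrite phiK.
- by move=> <-; rewrite psiK.
Qed.

Lemma gen_pull i A : gen i A -> gen (index_map phi i) (pull @^-1` A).
Proof.
by move=> [->|->|/atom_pull h]; [apply: Or31|apply: Or32|apply: Or33] => //; rewrite ?preimage_set0 ?preimage_setT.
Qed.

Lemma measurable_pull : measurable_fun setT pull.
Proof.
by apply: measurable_config => i A /atom_pull; exact: measurable_atom.
Qed.

Variable Q : probability C R.
Hypothesis Qlaw : oil_water_law Q.

Lemma law_gen_pull i A : gen i A -> Q (pull @^-1` A) = Q A.
Proof.
move=> [->|->|]; rewrite ?preimage_set0 ?preimage_setT//.
case: i => [[[[x|x]|[x k]]|[x k]]|[x k]] /= [a _ <-].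
- by rewrite (law_oil Qlaw) -(law_oil Qlaw (phi x)).
- by rewrite (law_wat Qlaw) -(law_wat Qlaw (phi x)).
- by rewrite (law_clk Qlaw) -(law_clk Qlaw (phi x) k).
- rewrite (law_zo Qlaw) phi_adj -size_nbrs_phi -(law_zo Qlaw (phi x) k); congr (Q _).
  apply/seteqP; split=> c /=; first by move=> <-; rewrite psiK.
  by move=> ->; rewrite phiK.
- rewrite (law_zw Qlaw) phi_adj -size_nbrs_phi -(law_zw Qlaw (phi x) k); congr (Q _).
  apply/seteqP; split=> c /=; first by move=> <-; rewrite psiK.
  by move=> ->; rewrite phiK.
Qed.

Lemma law_pull A : measurable A -> Q (pull @^-1` A) = Q A.
Proof.
pose push := @measure_function_pushforward__canonical__measure_function_Measure _ _ C C R.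
pose m : {measure set C -> \bar R} := push Q pull measurable_pull.
move=> mA; apply: (@cylinder_ext _ _ m Q) => //.
  change (Q (pull @^-1` setT) < +oo)%E.
  by rewrite preimage_setT (le_lt_trans (probability_le1 Q _))// ltry.
move=> S [s [F [us hF ->]]].
change (Q (pull @^-1` (\bigcap_(i in [set j | j \in s]) F i)) =
  Q (\bigcap_(i in [set j | j \in s]) F i)).
rewrite preimage_bigcap [in RHS](law_indep Qlaw)//.
pose F' j := pull @^-1` F (index_map psi j).
have -> : \bigcap_(i in [set j | j \in s]) pull @^-1` F i =
    \bigcap_(j in [set j | j \in map (index_map phi) s]) F' j.
  apply/seteqP; split=> c h j /=.
    move=> /mapP[i si ->]; rewrite /F' (index_mapK phiK); exact: h.
  move=> sj; have := h (index_map phi j); rewrite /F' (index_mapK phiK); apply.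
  by apply/mapP; exists j.
rewrite (law_indep Qlaw)//; last first.
- by move=> j; rewrite -[j](index_mapK psiK); rewrite /F' (index_mapK phiK); exact: gen_pull.
- by rewrite map_inj_uniq//; apply: (can_inj (index_mapK phiK)).
rewrite big_map; apply: eq_bigr => i _.
by rewrite /F' (index_mapK phiK) (@law_gen_pull i).
Qed.
End Law.

(** * Almost sure well-posedness *)

Lemma ae_forall_countable d (T : measurableType d) (R : realType) (mu : {measure set T -> \bar R})
    (I : countType) (A : I -> T -> Prop) :
  (forall i, \forall c \ae mu, A i c) -> \forall c \ae mu, forall i, A i c.
Proof.
move=> h.
have : \forall c \ae mu, forall n : nat, if unpickle n is Some i then A i c else True.
  by apply: ae_foralln => n; case: unpickle => [i|]; [exact: h|exact: aeW].
by apply: filterS => c hc i; have := hc (pickle i); rewrite pickleK.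
Qed.

Lemma ae_measure0 d (T : measurableType d) (R : realType) (mu : {measure set T -> \bar R})
    (A : set T) : measurable A -> mu A = 0%E -> \forall c \ae mu, ~ A c.
Proof. by move=> mA A0; exists A; split=> // c /=; rewrite notK. Qed.

Lemma le_measure_ae d (T : measurableType d) (R : realType) (mu : {measure set T -> \bar R})
    (A B : set T) : measurable A -> measurable B ->
  (\forall c \ae mu, A c -> B c) -> (mu A <= mu B)%E.
Proof.
move=> mA mB [N [mN N0 hN]].
have AB : A `<=` B `|` N.
  move=> c Ac; have [Bc|nBc] := pselect (B c); [by left|right; apply: hN => /=].
  by move=> /(_ Ac).
have := le_measure mu _ _ AB; rewrite !inE => /(_ mA (measurableU _ _ mB mN)) h.
apply: le_trans h _; rewrite -[leRHS]adde0 -N0; exact: measureU2.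
Qed.

Lemma measure0_le (R : realType) (x : \bar R) (u : nat -> R) :
  (0 <= x)%E -> (forall n, (x <= (u n)%:E)%E) -> u @ \oo --> (0 : R) -> x = 0%E.
Proof.
move=> x0 xu u0; apply/eqP; rewrite eq_le x0 andbT; apply/lee_addgt0Pr => e e0.
rewrite add0e.
have [n _ /(_ n (leqnn n)) /=] := (iffLR (cvgrPdist_lt _ _) u0) e e0.
rewrite sub0r normrN => h; apply: le_trans (xu n) _.
by rewrite lee_fin; apply/ltW; apply: le_lt_trans h; exact: ler_norm.
Qed.

Lemma prod_const_EFin (R : realType) (I : Type) (s : seq I) (a : R) :
  (\prod_(i <- s) a%:E = (a ^+ size s)%:E)%E.
Proof. by elim: s => [|i s ih]; rewrite ?big_nil// big_cons ih -EFinM exprS. Qed.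

Section LocalFiniteness.
Variables (R : realType) (V : countType) (nbrs : V -> seq V) (nu : nat -> R).
Local Notation C := (config R V).
Variable Q : probability C R.
Hypothesis Qlaw : oil_water_law nbrs nu Q.

Lemma ae_clk_pos : \forall c \ae Q, forall x k, 0 < clk c x k.
Proof.
have h : \forall c \ae Q, forall e : V * nat, ~ [set c : C | clk c e.1 e.2 <= 0] c.
  apply: ae_forall_countable => -[x k]; apply: ae_measure0.
    by apply: (@measurable_atom _ _ (iE x k)); exists 0.
  by rewrite /= (law_clk Qlaw) lexx oppr0 expR0 subrr.
by apply: filterS h => c hc x k; have /negP := hc (x, k); rewrite -ltNge.
Qed.

Definition early_prob (t : R) : R := 1 - expR (- t).

Lemma early_prob_lt1 t : early_prob t < 1.
Proof. by rewrite /early_prob ltrBlDr ltrDl expR_gt0. Qed.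

Lemma early_prob_ge0 t : 0 <= t -> 0 <= early_prob t.
Proof. by move=> t0; rewrite /early_prob subr_ge0 -expR0 ler_expR oppr_le0. Qed.

Lemma measurable_rt_le x k (t : R) : measurable [set c : C | rt c x k <= t].
Proof.
by apply: measurable_set_bool; apply: measurable_fun_ler => //; exact: measurable_rt.
Qed.

(* If the ring [k] occurs by time [t], all of the first [k + 1] interarrival times are
   at most [t]. *)
Lemma rt_le_prob x k (t : R) : 0 <= t ->
  (Q [set c : C | (rt c x k <= t)%R] <= (early_prob t ^+ k.+1)%:E)%E.
Proof.
move=> t0.
pose F (i : rv_index V) : set C :=
  match i with inl (inl (inr (y, j))) => [set c | clk c y j <= t] | _ => setT end.
pose s := [seq iE x j | j <- iota 0 k.+1].
have hF i : gen i (F i).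
  case: i => [[[[y|y]|[y j]]|[y j]]|[y j]] /=; try by apply: Or32.
  by apply: Or33; exists t.
have us : uniq s by rewrite map_inj_uniq ?iota_uniq// => a b [].
have -> : ((early_prob t ^+ k.+1)%:E = Q (\bigcap_(i in [set j | j \in s]) F i))%E.
  rewrite (law_indep Qlaw us hF) /s big_map (eq_bigr (fun=> (early_prob t)%:E)); last first.
    by move=> j _ /=; rewrite (law_clk Qlaw) t0.
  by rewrite prod_const_EFin size_iota.
apply: le_measure_ae; first exact: measurable_rt_le.
  by apply: measurable_cylinder; exists s, F.
apply: filterS ae_clk_pos => c pos /= ht i /= /mapP[j]; rewrite mem_iota add0n => /andP[_ jk] -> /=.
apply: le_trans ht; rewrite /rt /ring_time (bigD1 (Ordinal jk))//= lerDl.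
by apply: sumr_ge0 => i0 _; exact: ltW.
Qed.

Lemma early_prob_cvg t : (0 <= t) -> (fun k => early_prob t ^+ k.+1) @ \oo --> (0 : R).
Proof.
move=> t0; have h := @cvg_expr R (early_prob t).
rewrite (_ : (fun k => early_prob t ^+ k.+1) = (fun k => early_prob t ^+ (k + 1))); last first.
  by apply/funext => k; rewrite addn1.
by rewrite (cvg_shiftn 1 (fun k => early_prob t ^+ k)); apply: h; rewrite ger0_norm ?early_prob_lt1 ?early_prob_ge0.
Qed.

Lemma ae_locally_finite : \forall c \ae Q, forall x (t : R), exists k, t < rt c x k.
Proof.
have h : \forall c \ae Q, forall e : V * nat,
    ~ (\bigcap_k [set c : C | rt c e.1 k <= e.2%:R]) c.
  apply: ae_forall_countable => -[x n] /=; apply: ae_measure0.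
    by apply: bigcapT_measurable => k; exact: measurable_rt_le.
  apply: (@measure0_le _ _ (fun k => early_prob n%:R ^+ k.+1)) => //.
    move=> k; apply: le_trans (rt_le_prob x k (ler0n R n)).
    apply: le_measure; rewrite ?inE; [|exact: measurable_rt_le|exact: bigcap_inf].
    by apply: bigcapT_measurable => j; exact: measurable_rt_le.
  exact: early_prob_cvg.
apply: filterS h => c hc x t.
have := hc (x, Num.Def.archi_bound `|t|); apply: contra_notP => /forallNP nk k _ /=.
have /negP := nk k; rewrite -leNgt => /le_trans; apply.
by apply: ltW; apply: le_lt_trans (ler_norm t) _; exact: archi_boundP.
Qed.
End LocalFiniteness.

(** * Backward chains of influence and percolation in short time windows *)

Section Walks.
Variables (V : countType) (nbrs : V -> seq V).

(** The starting vertex is left out, so that a walk of [n] steps has [n] entries and gives an [n]-th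
    power in the estimate of its probability. *)
Fixpoint walks n (x : V) : seq (seq V) :=
  if n is m.+1 then flatten [seq [seq y :: p | p <- walks m y] | y <- nbrs x] else [:: [::]].

Lemma mem_walks n x p : path (Defs.adjacent nbrs) x p -> size p = n -> p \in walks n x.
Proof.
elim: n x p => [|n ih] x [|y p] //= /andP[hy hp] [sp].
by apply/flatten_mapP; exists y => //; apply: map_f; exact: ih.
Qed.

Lemma size_walks n x D : (forall y, size (nbrs y) = D) -> size (walks n x) = (D ^ n)%N.
Proof.
move=> hD; elim: n x => [//|n ih] x /=.
rewrite size_flatten /shape -map_comp (eq_map (g := fun=> D ^ n)%N); last first.
  by move=> y /=; rewrite size_map ih.
by rewrite sumnE big_map big_const_seq count_predT iter_addn addn0 hD expnS mulnC.
Qed.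

Lemma size_mem_walks n x p : p \in walks n x -> size p = n.
Proof.
elim: n x p => [|n ih] x p /=; first by rewrite inE => /eqP ->.
by move=> /flatten_mapP[y _ /mapP[q /ih hq ->]] /=; rewrite hq.
Qed.
End Walks.

Lemma union_bound d (T : measurableType d) (R : realType) (mu : {measure set T -> \bar R})
    (I : eqType) (s : seq I) (F : I -> set T) (b : R) :
  (forall i, measurable (F i)) -> (forall i, i \in s -> (mu (F i) <= b%:E)%E) ->
  measurable [set c | exists2 i, i \in s & F i c] /\
  (mu [set c | exists2 i, i \in s & F i c] <= ((size s)%:R * b)%:E)%E.
Proof.
move=> mF; elim: s => [|i s ih] h.
  rewrite (_ : [set c | _] = set0); first by rewrite measure0 mul0r.
  by apply/seteqP; split=> c //= [].
rewrite (_ : [set c | _] = F i `|` [set c | exists2 i, i \in s & F i c]); last first.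
  apply/seteqP; split=> c /=.
    by move=> [j]; rewrite inE => /orP[/eqP ->|js] Fj; [left|right; exists j].
  by move=> [Fi|[j js Fj]]; [exists i => //; rewrite mem_head|exists j => //; rewrite inE js orbT].
have [j js|m le] := ih; first by apply: h; rewrite inE js orbT.
split; first exact: measurableU.
apply: le_trans (measureU2 _ _ _) _ => //.
rewrite -natr1 mulrDl mul1r addrC EFinD; apply: leeD => //.
by apply: h; rewrite mem_head.
Qed.

Section Windows.
Variables (R : realType) (V : countType) (nbrs : V -> seq V) (nu : nat -> R).
Local Notation C := (config R V).
Hypothesis nbrs_uniq : forall x, uniq (nbrs x).
Hypothesis nbrs_transitive : vertex_transitive nbrs.
Variable Q : probability C R.
Hypothesis Qlaw : oil_water_law nbrs nu Q.

(** The centre [a] is removed from the window so that, as the window shrinks to [a], local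
    finiteness alone makes the event disappear. This costs nothing, since a strictly decreasing
    chain of times meets [a] at most once. *)
Definition rings_in (p q a : R) (y : V) : set C :=
  [set c | exists k, (p < rt c y k < a) || (a < rt c y k < q)].

Lemma measurable_rings_in p q a y : measurable (rings_in p q a y).
Proof.
rewrite (_ : rings_in p q a y = \bigcup_k [set c | (p < rt c y k < a) || (a < rt c y k < q)]).
  apply: bigcup_measurable => k _; apply: measurable_set_bool.
  by apply: measurable_or; apply: measurable_and; apply: measurable_fun_ltr => //; exact: measurable_rt.
by apply/seteqP; split=> c [k]; [exists k|exists k].
Qed.

Definition clocks_of (y : V) : pred (rv_index V) :=
  fun i => if i is inl (inl (inr (z, _))) then z == y else false.

Lemma rt_keep (J : pred (rv_index V)) (c : C) y k :
  (forall j, J (iE y j)) -> rt (keep J c) y k = rt c y k.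
Proof. by move=> h; apply: eq_bigr => j _ /=; rewrite h. Qed.

Lemma rings_in_indep p q a s : uniq s ->
  measurable (\bigcap_(y in [set z | z \in s]) rings_in p q a y) /\
  (Q (\bigcap_(y in [set z | z \in s]) rings_in p q a y) = \prod_(y <- s) Q (rings_in p q a y))%E.
Proof.
elim: s => [_|y s ih /= /andP[ys us]].
  rewrite big_nil (_ : \bigcap_(y in _) _ = setT) ?probability_setT//.
  by apply/seteqP; split=> c // _ z.
have [mS QS] := ih us.
have -> : \bigcap_(z in [set z | z \in y :: s]) rings_in p q a z =
    rings_in p q a y `&` \bigcap_(z in [set z | z \in s]) rings_in p q a z.
  apply/seteqP; split=> c /=.
    move=> h; split; first by apply: h; rewrite /= mem_head.
    by move=> z /= zs; apply: h; rewrite /= inE zs orbT.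
  by move=> [h1 h2] z /=; rewrite inE => /orP[/eqP -> //|]; exact: h2.
split; first by apply: measurableI => //; exact: measurable_rings_in.
rewrite big_cons -QS; apply: (independent_blocks (law_indep Qlaw) (J := clocks_of y)) => //.
- exact: measurable_rings_in.
- apply/seteqP; split=> c [k] h; exists k; move: h; rewrite rt_keep//= => j; exact: eqxx.
- apply/seteqP; split=> c h z /= zs; have [k hk] := h z zs; exists k; move: hk;
    rewrite rt_keep//= => j; apply: contraNneq ys => <-; exact: zs.
Qed.

Lemma law_transitive (A : V -> set C) x y : (forall z, measurable (A z)) ->
  (forall phi psi : V -> V, cancel phi psi -> cancel psi phi ->
    (forall a b, (b \in nbrs a) = (phi b \in nbrs (phi a))) ->
    forall z, pull phi psi @^-1` A z = A (phi z)) -> Q (A y) = Q (A x).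
Proof.
move=> mA hA; have [phi [[psi phiK psiK] [<- adj]]] := nbrs_transitive x y.
by rewrite -(hA _ _ phiK psiK adj) (law_pull nbrs_uniq phiK psiK adj Qlaw).
Qed.

Lemma degree_const x y : size (nbrs x) = size (nbrs y).
Proof.
have [phi [[psi phiK psiK] [<- adj]]] := nbrs_transitive y x.
by rewrite (size_nbrs_phi nbrs_uniq phiK psiK adj).
Qed.

Lemma rings_in_transitive p q a x y : Q (rings_in p q a y) = Q (rings_in p q a x).
Proof. by apply: law_transitive => // z; exact: measurable_rings_in. Qed.

(** The endpoints are rational so that countably many windows suffice later. *)
Lemma small_window x (a e : R) : 0 < e -> exists p q : rat,
  ratr p < a < ratr q /\ (Q (rings_in (ratr p) (ratr q) a x) <= e%:E)%E.
Proof.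
move=> e0.
pose F n := rings_in (a - n.+1%:R^-1) (a + n.+1%:R^-1) a x.
have mF n : measurable (F n) by exact: measurable_rings_in.
have mcap : measurable (\bigcap_n F n) by exact: bigcapT_measurable.
have dF : nonincreasing_seq F.
  move=> m n mn; apply/subsetPset => c [k hk]; exists k.
  have h : (n.+1%:R^-1 <= m.+1%:R^-1 :> R) by rewrite lef_pV2 ?posrE ?ltr0n// ler_nat.
  case/orP: hk => /andP[h1 h2]; apply/orP; [left|right]; apply/andP; split=> //.
    by apply: le_lt_trans h1; rewrite lerD2l lerN2.
  by apply: lt_le_trans h2 _; rewrite lerD2l.
have cap0 : Q (\bigcap_n F n) = 0%E.
  have := ae_locally_finite Qlaw; rewrite -(measure0 Q) => lf.
  apply/eqP; rewrite eq_le; apply/andP; split; last by rewrite measure0.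
  apply: le_measure_ae => //; apply: filterS2 lf (ae_clk_pos Qlaw) => c lf pos hc.
  (* Rings from index [N] on come after [a + 1], outside all the windows. The finitely many others
     that differ from [a] stay at a positive distance from it. *)
  exfalso; have [N hN] := lf x (a + 1).
  have mono k : (N <= k)%N -> a + 1 < rt c x k.
    by move=> Nk; apply: lt_le_trans hN _; exact: rt_mono.
  have [n hn] : exists n, forall k, (k < N)%N -> rt c x k != a -> n.+1%:R^-1 <= `|rt c x k - a|.
    elim: (N) => [|M [n ih]]; first by exists 0%N.
    have [ea|ne] := eqVneq (rt c x M) a.
      by exists n => k; rewrite ltnS leq_eqVlt => /orP[/eqP ->|/ih //]; rewrite ea eqxx.
    have d0 : 0 < `|rt c x M - a| by rewrite normr_gt0 subr_eq0.
    pose n' := Num.Def.archi_bound (`|rt c x M - a|^-1).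
    have hn' : n'.+1%:R^-1 <= `|rt c x M - a|.
      rewrite -[leRHS]invrK lef_pV2 ?posrE ?invr_gt0 ?ltr0n//.
      apply: ltW; apply: lt_trans (archi_boundP _) _; first by rewrite invr_ge0.
      by rewrite ltr_nat.
    have mono' (i j : nat) : (i <= j)%N -> j.+1%:R^-1 <= i.+1%:R^-1 :> R.
      by move=> ij; rewrite lef_pV2 ?posrE ?ltr0n// ler_nat.
    exists (maxn n n') => k; rewrite ltnS leq_eqVlt => /orP[/eqP ->|kM] kne.
      by apply: le_trans hn'; apply: mono'; exact: leq_maxr.
    by apply: le_trans (ih _ kM kne); apply: mono'; exact: leq_maxl.
  have [k hk] := hc n Logic.I.
  have n1 : n.+1%:R^-1 <= 1 :> R by rewrite invf_le1 ?ltr0n// ler1n.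
  have i0 : 0 < n.+1%:R^-1 :> R by rewrite invr_gt0 ltr0n.
  have [kN|/mono kN] := ltnP k N; last first.
    by case/orP: hk => /andP[h1 h2]; move: n1 h1 h2 kN; generalize (n.+1%:R^-1 : R) (rt c x k) => i v; lra.
  have kne : rt c x k != a by case/orP: hk => /andP[h1 h2]; [rewrite lt_eqF|rewrite gt_eqF].
  have := hn _ kN kne; rewrite leNgt => /negP; apply.
  rewrite ltr_norml ltrBrDr ltrBlDr [(- _ + a)]addrC [_ + a]addrC.
  case/orP: hk => /andP[h1 h2]; apply/andP; split=> //.
    by apply: lt_trans h2 _; rewrite ltrDl.
  by apply: lt_trans h1; rewrite gtrDl oppr_lt0.
have cv : Q \o F @ \oo --> Q (\bigcap_n F n).
  apply: nonincreasing_cvg_mu => //.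
  by rewrite (le_lt_trans (probability_le1 Q _))// ltry.
rewrite cap0 in cv.
have [n hn] : exists n, (Q (F n) <= e%:E)%E.
  have [n _ /(_ n (leqnn n)) h] := cvgr_lt _ (fine_cvg cv) _ e0.
  by exists n; rewrite -[leLHS]fineK ?lee_fin ?fin_num_measure//; exact: ltW.
have i0 : 0 < n.+1%:R^-1 :> R by rewrite invr_gt0 ltr0n.
have [p hp] : exists p, ratr p \in `]a - n.+1%:R^-1, a[ by apply: rat_in_itvoo; rewrite ltrBlDr ltrDl.
have [q hq] : exists q, ratr q \in `]a, a + n.+1%:R^-1[ by apply: rat_in_itvoo; rewrite ltrDl.
move: hp hq; rewrite !in_itv /= => /andP[p1 p2] /andP[q1 q2].
exists p, q; split; first by rewrite p2 q1.
apply: le_trans hn; apply: le_measure; rewrite ?inE; try exact: measurable_rings_in.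
move=> c [k hk]; exists k; case/orP: hk => /andP[h1 h2]; apply/orP; [left|right]; apply/andP; split=> //.
  exact: lt_trans h1.
exact: lt_trans q2.
Qed.
End Windows.

Lemma well_founded_no_chain (T : Type) (r : T -> T -> Prop) :
  (forall f : nat -> T, ~ forall n, r (f n.+1) (f n)) -> well_founded r.
Proof.
move=> h a; apply: contrapT => na.
have step (x : {x | ~ Acc r x}) : exists y : {x | ~ Acc r x}, r (sval y) (sval x).
  case: x => x nx /=; apply: contrapT => /forallNP hy; apply: nx; constructor=> y ryx.
  by apply: contrapT => ny; apply: (hy (exist _ y ny)).
have [g hg] := choice step.
apply: (h (fun n => sval (iter n g (exist _ a na)))) => n; exact: hg.
Qed.

Section WellFoundedness.
Variables (R : realType) (V : countType) (nbrs : V -> seq V).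
Local Notation C := (config R V).

(** In percolation terms, a site is open if its clock rings in the punctured window. Only finitely
    many sites can then be reached from [x] through open sites. *)
Definition no_open_walks (p q a : R) (c : C) (x : V) :=
  exists n, forall w, w \in walks nbrs n x -> uniq w -> exists2 y, y \in w & ~ rings_in p q a y c.

(** The times along an infinite backward chain decrease to a limit [L] and finally stay in the
    punctured window around it. From then on the chain moves through open sites, hence in a finite
    set of sites, each with finitely many rings before [q]. But the events of the chain are pairwise
    distinct. *)
Lemma precedes_wf (c : C) :
  (forall x k, 0 < clk c x k) -> (forall x (t : R), exists k, t < rt c x k) ->
  (forall L : R, exists p q a : R, p < L < q /\ forall x, no_open_walks p q a c x) ->
  well_founded (precedes nbrs c).
Proof.
move=> pos lf hL; apply: well_founded_no_chain => f hf.
pose tau n := rt c (f n).1 (f n).2.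
have rt0 x k : 0 <= rt c x k by apply: sumr_ge0 => i _; exact: ltW.
have tauS n : tau n.+1 < tau n by have [] := hf n.
have tau_lt m n : (m < n)%N -> tau n < tau m.
  elim: n => [//|n ih]; rewrite ltnS leq_eqVlt => /orP[/eqP ->//|/ih]; exact: lt_trans.
have finf : has_inf (range tau).
  by split; [exists (tau 0%N); exists 0%N|exists 0 => _ [n _ <-]; exact: rt0].
pose L := inf (range tau).
have Ltau n : L <= tau n by apply: ge_inf; [case: finf|exists n].
have [p [q [a [/andP[pL Lq] hw]]]] := hL L.
have [N1 hN1] : exists n, tau n < q.
  have [_ [n _ <-] h] := inf_adherent (etrans (subr_gt0 _ _) Lq) finf.
  by exists n; move: h; rewrite addrC subrK.
(* If the chain passes through the time [a], then [N] is taken just after this passage. *)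
have [N hN] : exists N, forall n, (N <= n)%N -> tau n < q /\ ((p < tau n < a) || (a < tau n < q)).
  have tq n : (N1 <= n)%N -> tau n < q.
    by rewrite leq_eqVlt => /orP[/eqP <-//|/tau_lt/lt_trans]; apply.
  have pt n : p < tau n by exact: lt_le_trans (Ltau n).
  have [[n0 [n01 e0]]|ne] := pselect (exists n0, (N1 <= n0)%N /\ tau n0 = a).
    exists n0.+1 => n n0n; split; first by apply: tq; apply: leq_trans n01 (ltnW n0n).
    by rewrite pt /= -e0 tau_lt.
  exists N1 => n N1n; split; first exact: tq.
  rewrite pt tq// andbT /=; apply/orP.
  have [h|h|h] := ltgtP (tau n) a; [by left|by right|].
  by exfalso; apply: ne; exists n.
have op n : (N <= n)%N -> rings_in p q a (f n).1 c by move=> /hN[_ h]; exists (f n).2.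
pose x0 := (f N).1.
have [m hm] := hw x0.
(* A step of the chain that stays at its site adds nothing to the walk. *)
have walk n : exists w, [/\ path (Defs.adjacent nbrs) x0 w, last x0 w = (f (N + n)%N).1 &
    forall y, y \in w -> rings_in p q a y c].
  elim: n => [|n [w [pw lw ow]]]; first by exists [::]; rewrite addn0.
  rewrite addnS; have [] := hf (N + n)%N; rewrite inE => /orP[/eqP e _|e _].
    by exists w; rewrite lw e.
  exists (rcons w (f (N + n).+1).1); rewrite rcons_path last_rcons pw lw; split=> //.
  move=> y; rewrite mem_rcons inE => /orP[/eqP ->|]; last exact: ow.
  by apply: op; rewrite -addnS leq_addr.
(* Erasing loops turns the walk into a self-avoiding open one. It has fewer than [m] steps, for
   otherwise its first [m] steps would contradict the choice of [m]. *)
pose S := [seq last x0 w | j <- iota 0 m, w <- walks nbrs j x0].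
have inS n : (f (N + n)%N).1 \in S.
  have [w [pw <- ow]] := walk n.
  case: (shortenP pw) ow => w' pw' /= /andP[_ uw'] sub ow.
  have [sm|ms] := ltnP (size w') m.
    apply/allpairsPdep; exists (size w'), w'; split=> //.
      by rewrite mem_iota.
    exact: mem_walks.
  have tw : take m w' \in walks nbrs m x0.
    by apply: mem_walks; [exact: take_path|rewrite size_takel].
  have [y yt ny] := hm _ tw (take_uniq _ uw').
  exfalso; apply: ny; apply: ow; exact/sub/(mem_take yt).
have [K hK] := @choice _ _ (fun x k => q < rt c x k) (fun x => lf x q).
pose T := [seq (y, k) | y <- S, k <- iota 0 (K y)].
have inT n : f (N + n)%N \in T.
  apply/allpairsPdep; exists (f (N + n)%N).1, (f (N + n)%N).2; split=> //; last by case: (f _).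
  rewrite mem_iota add0n /= ltnNge; apply/negP => /(rt_mono (pos (f (N + n)%N).1)).
  rewrite leNgt => /negP; apply; apply: lt_trans (hK _).
  by have [] := hN (N + n)%N (leq_addr _ _).
have inj : injective f.
  move=> i j fij; have [ij|ij|//] := ltngtP i j; have := tau_lt _ _ ij; by rewrite /tau fij ltxx.
have us : uniq [seq f (N + n)%N | n <- iota 0 (size T).+1].
  by rewrite map_inj_uniq ?iota_uniq// => i j /inj /addnI.
have sub : {subset [seq f (N + n)%N | n <- iota 0 (size T).+1] <= T} by move=> e /mapP[n _ ->].
by have := uniq_leq_size us sub; rewrite size_map size_iota ltnn.
Qed.
Variable nu : nat -> R.
Hypothesis nbrs_uniq : forall x, uniq (nbrs x).
Hypothesis nbrs_transitive : vertex_transitive nbrs.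
Variable Q : probability C R.
Hypothesis Qlaw : oil_water_law nbrs nu Q.
Variables (D : nat).
Hypothesis degD : forall x, size (nbrs x) = D.

(* Small enough for a union bound over the [D ^ n] walks of length [n]. *)
Definition window_prob : R := (D.+1.*2)%:R^-1.

(** Clocks at distinct sites are independent, so a self-avoiding walk of [n] steps is open with
    probability at most [window_prob ^+ n]. The union bound over all such walks from [x] is at most
    [2^-n], which tends to 0. *)
Lemma no_open_walks_ae p q a x : (Q (rings_in p q a x) <= window_prob%:E)%E ->
  \forall c \ae Q, no_open_walks p q a c x.
Proof.
move=> hx.
have hy y : (Q (rings_in p q a y) <= window_prob%:E)%E.
  by rewrite (rings_in_transitive nbrs_uniq nbrs_transitive Qlaw p q a x y).
pose F w : set C := if uniq w then \bigcap_(y in [set z | z \in w]) rings_in p q a y else set0.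
have mF w : measurable (F w).
  by rewrite /F; case: ifP => // /(rings_in_indep Qlaw p q a)[].
have w0 : 0 <= window_prob by rewrite /window_prob invr_ge0.
have QF n w : w \in walks nbrs n x -> (Q (F w) <= (window_prob ^+ n)%:E)%E.
  move=> /size_mem_walks <-; rewrite /F; case: ifP => [/(rings_in_indep Qlaw p q a)[_ ->]|_].
    rewrite -prod_const_EFin; elim: w => [|y w ih]; rewrite ?big_nil// !big_cons.
    by apply: lee_pmul => //; apply: prode_ge0 => i _.
  by rewrite measure0 lee_fin exprn_ge0.
pose B n := [set c | exists2 w, w \in walks nbrs n x & F w c].
have hB n : measurable (B n) /\ (Q (B n) <= (2%:R^-1 ^+ n)%:E)%E.
  have [mB le] := union_bound mF (QF n); split=> //; apply: le_trans le _.
  rewrite (size_walks _ _ degD) natrX -exprMn lee_fin.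
  apply: lerXn2r; rewrite ?nnegrE ?mulr_ge0//.
  rewrite /window_prob -muln2 natrM invfM mulrA ler_piMl//.
  by rewrite ler_pdivrMr// mul1r ler_nat.
have mB : measurable (\bigcap_n B n) by apply: bigcapT_measurable => n; case: (hB n).
have null : Q (\bigcap_n B n) = 0%E.
  apply: (@measure0_le _ _ (fun n => 2%:R^-1 ^+ n)) => //.
    move=> n; have [mBn Bn] := hB n; apply: le_trans Bn.
    by apply: le_measure; rewrite ?inE//; exact: bigcap_inf.
  by apply: cvg_expr; rewrite ger0_norm// invf_lt1// ltr1n.
apply: filterS (ae_measure0 mB null) => c hc; apply: contrapT => /forallNP hn; apply: hc => n _.
apply: contrapT => nB; apply: (hn n) => w wn uw; apply: contrapT => ny; apply: nB; exists w => //.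
rewrite /F uw => y /= yw; apply: contrapT => no; apply: ny; by exists y.
Qed.

(** The limit [L] of a chain depends on the configuration, so an exceptional null set for each [L]
    would not do. Each rational window receives one centre fixed in advance, not necessarily [L],
    which leaves countably many null sets. *)
Lemma precedes_wf_ae : \forall c \ae Q, well_founded (precedes nbrs c).
Proof.
have [[x0 _]|noV] := pselect (exists x0 : V, True); last first.
  by apply: aeW => c [x k]; exfalso; apply: noV; exists x.
pose small (e : rat * rat) : set R := [set a | ratr e.1 < a < ratr e.2 /\
   (Q (rings_in (ratr e.1) (ratr e.2) a x0) <= window_prob%:E)%E].
pose center (e : rat * rat) : R := xget 0 (small e).
have h : \forall c \ae Q, forall e : (rat * rat) * V, (small e.1 !=set0) ->
    no_open_walks (ratr e.1.1) (ratr e.1.2) (center e.1) c e.2.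
  apply: ae_forall_countable => -[e x] /=.
  have [[a ha]|ne] := pselect (small e !=set0); last by apply: aeW.
  have [_ le] : small e (center e) by apply: xgetPex; exists a.
  apply: filterS (@no_open_walks_ae (ratr e.1) (ratr e.2) (center e) x _) => //.
  by rewrite (rings_in_transitive nbrs_uniq nbrs_transitive Qlaw _ _ _ x0 x).
apply: filterS3 h (ae_clk_pos Qlaw) (ae_locally_finite Qlaw) => c hc pos lf.
apply: precedes_wf => // L.
have wp0 : 0 < window_prob by rewrite /window_prob invr_gt0 ltr0n double_gt0.
(* [L] itself is an admissible centre of this window, so the centre chosen for the window is
   admissible too. *)
have [p [q [pLq le]]] := small_window Qlaw x0 L wp0.
have ne : small (p, q) !=set0 by exists L.
exists (ratr p), (ratr q), (center (p, q)); split=> // x.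
exact: (hc (p, q, x)).
Qed.
End WellFoundedness.

(** * The balance of a site and its visits to a level *)

Section Telescoping.
Variables (T : eqType) (lt : rel T).
Hypotheses (lt_irr : irreflexive lt) (lt_trans : transitive lt)
  (lt_total : forall a b, a != b -> lt a b || lt b a).
Variables (da db : T -> nat) (g : nat -> nat -> int).

Let telescope_sorted (s : seq T) (A0 B0 : nat) : pairwise lt s ->
  \sum_(e <- s) (g (A0 + \sum_(e' <- s | lt e' e) da e' + da e)%N
                   (B0 + \sum_(e' <- s | lt e' e) db e' + db e)%N
               - g (A0 + \sum_(e' <- s | lt e' e) da e')%N (B0 + \sum_(e' <- s | lt e' e) db e')%N)
  = g (A0 + \sum_(e <- s) da e)%N (B0 + \sum_(e <- s) db e)%N - g A0 B0.
Proof.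
elim/last_ind: s => [|s e ih]; first by rewrite !big_nil !addn0 subrr.
rewrite pairwise_rcons => /andP[/allP hall hs].
rewrite -cats1 big_cat big_seq1 /=.
have last_sum (h : T -> nat) : (\sum_(e' <- s ++ [:: e] | lt e' e) h e' = \sum_(e' <- s) h e')%N.
  rewrite big_cat /= big_mkcond /= big_seq_cond [X in (_ + X)%N]big_mkcond big_seq1 lt_irr addn0.
  by rewrite [RHS]big_seq; apply: eq_big => [e0|e0 /andP[e0s _]]; rewrite ?andbT// hall.
have early_sum (h : T -> nat) e0 : e0 \in s ->
    (\sum_(e' <- s ++ [:: e] | lt e' e0) h e' = \sum_(e' <- s | lt e' e0) h e')%N.
  move=> e0s; rewrite big_cat /= [X in (_ + X)%N]big_mkcond big_seq1.
  case: ifP => [h0|_]; last by rewrite addn0.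
  by have := lt_trans h0 (hall _ e0s); rewrite lt_irr.
rewrite !last_sum !big_cat !big_seq1 /= !addnA.
have -> : forall u v w w' : int, w + (u - v) = u - w' <-> w = v - w'.
  by move=> u v w w'; split=> h; lia.
rewrite -ih//; rewrite big_seq [RHS]big_seq; apply: eq_bigr => e0 e0s.
by rewrite !early_sum.
Qed.

(** The list need not be in order of time: [A e] and [B e] refer to [lt] only, so the sum may be
    rearranged along the sorted list, where it telescopes. *)
Lemma telescope (s : seq T) (fired : pred T) (A0 B0 : nat) : uniq s ->
  let A e := (A0 + \sum_(e' <- s | lt e' e && fired e') da e')%N in
  let B e := (B0 + \sum_(e' <- s | lt e' e && fired e') db e')%N in
  \sum_(e <- s | fired e) (g (A e + da e)%N (B e + db e)%N - g (A e) (B e))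
  = g (A0 + \sum_(e <- s | fired e) da e)%N (B0 + \sum_(e <- s | fired e) db e)%N - g A0 B0.
Proof.
move=> us A B.
pose le a b := (a == b) || lt a b.
pose s' := sort le [seq e <- s | fired e].
have ps : perm_eq [seq e <- s | fired e] s' by rewrite perm_sym perm_sort.
have us' : uniq s' by rewrite sort_uniq filter_uniq.
have letot : total le.
  by move=> a b; rewrite /le; case: (eqVneq a b) => //= /lt_total.
have letr : transitive le.
  move=> b a d; rewrite /le => /orP[/eqP->//|ab] /orP[/eqP <-|bd]; first by rewrite ab orbT.
  by rewrite (lt_trans ab bd) orbT.
have pw : pairwise lt s'.
  have : sorted le s' by apply: sort_sorted.
  rewrite (sorted_pairwise letr); move: us'; rewrite uniq_pairwise => h1 h2.
  have : pairwise [rel a b | (a != b) && le a b] s' by rewrite pairwise_relI h1.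
  by apply: sub_pairwise => a b /= /andP[/negbTE ab]; rewrite /le ab.
have E (U : nmodType) (h : T -> U) : \sum_(e <- s | fired e) h e = \sum_(e <- s') h e.
  by rewrite -big_filter (perm_big _ ps).
have En (P : pred T) (h : T -> nat) : (\sum_(e <- s | P e && fired e) h e = \sum_(e <- s' | P e) h e)%N.
  rewrite (eq_bigl (fun e => fired e && P e)) => [|e]; last by rewrite andbC.
  by rewrite -big_filter_cond (perm_big _ ps).
have En' (h : T -> nat) : (\sum_(e <- s | fired e) h e = \sum_(e <- s') h e)%N.
  by rewrite -big_filter (perm_big _ ps).
rewrite E !En' -telescope_sorted//; apply: eq_bigr => e _.
by rewrite /A /B !En.
Qed.
End Telescoping.

(* A discrete Tanaka formula. *)
Lemma tanaka_step (a b : nat) (m : int) (da db : bool) :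
  (`|(a + da)%:Z - (b + db)%:Z - m| - `|a%:Z - b%:Z - m| =
  ((m < a%:Z - b%:Z) && da)%:Z + ((a%:Z - b%:Z < m) && db)%:Z
  + ((a%:Z - b%:Z == m) && (da != db))%:Z
  - ((m < a%:Z - b%:Z) && db)%:Z - ((a%:Z - b%:Z < m) && da)%:Z :> int)%R.
Proof.
case: da; case: db; rewrite /= ?andbT ?andbF ?addn0 ?addn1;
  case: (ltrgtP m (a%:Z - b%:Z)) => h /=; lia.
Qed.

Section TanakaSum.
Variables (T : eqType) (lt : rel T).
Hypotheses (lt_irr : irreflexive lt) (lt_trans : transitive lt)
  (lt_total : forall a b, a != b -> lt a b || lt b a).

(** The negative terms of [tanaka_step] stand on the left, so that both sides are natural numbers
    and their expectations are sums of probabilities. The two sums differ by exchanging [da] and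
    [db], apart from the term at level [m]. *)
Lemma tanaka (s : seq T) (fired da db : pred T) (A0 B0 : nat) (m : int) : uniq s ->
  let A e := (A0 + \sum_(e' <- s) [&& lt e' e, fired e' & da e'])%N in
  let B e := (B0 + \sum_(e' <- s) [&& lt e' e, fired e' & db e'])%N in
  let D e := ((A e)%:Z - (B e)%:Z)%R in
  (`|((A0 + \sum_(e <- s) (fired e && da e))%N%:Z - (B0 + \sum_(e <- s) (fired e && db e))%N%:Z - m)%R|
    + \sum_(e <- s) (((fired e && (m < D e)%R) && db e) + ((fired e && (D e < m)%R) && da e))
  = `|(A0%:Z - B0%:Z - m)%R|
    + \sum_(e <- s) (((fired e && (m < D e)%R) && da e) + ((fired e && (D e < m)%R) && db e)
       + ((fired e && (D e == m)) && (da e != db e))))%N.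
Proof.
move=> us A B D.
have S (P : pred T) (h : T -> nat) : (\sum_(e <- s | P e) h e = \sum_(e <- s) P e * h e)%N.
  by rewrite big_mkcond; apply: eq_bigr => e _; case: (P e); rewrite ?mul1n ?mul0n.
have H := @telescope T lt lt_irr lt_trans lt_total (fun e => da e) (fun e => db e)
  (fun a b => `|a%:Z - b%:Z - m|%R) s fired A0 B0 us.
have EA (h : pred T) e : (\sum_(e' <- s | lt e' e && fired e') h e' =
    \sum_(e' <- s) [&& lt e' e, fired e' & h e'])%N.
  by rewrite S; apply: eq_bigr => e' _; rewrite mulnb andbA.
have EB (h : pred T) : (\sum_(e' <- s | fired e') h e' = \sum_(e' <- s) (fired e' && h e'))%N.
  by rewrite S; apply: eq_bigr => e' _; rewrite mulnb.
move: H => /=; rewrite !EB.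
under eq_bigr => e _ do rewrite !EA tanaka_step -/(A e) -/(B e) -/(D e).
rewrite big_mkcond /=.
set X := (fun e => ((fired e && (m < D e)%R) && db e) + ((fired e && (D e < m)%R) && da e))%N.
set Y := (fun e => ((fired e && (m < D e)%R) && da e) + ((fired e && (D e < m)%R) && db e)
       + ((fired e && (D e == m)) && (da e != db e)))%N.
have PS (h : T -> nat) : (\sum_(e <- s) h e)%N%:Z = \sum_(e <- s) (h e)%:Z.
  by rewrite -natz natr_sum; apply: eq_bigr => e _; rewrite natz.
rewrite (eq_bigr (fun e => (Y e)%:Z - (X e)%:Z)); last first.
  by move=> e _; rewrite /X /Y; case: (fired e) => //=; rewrite !PoszD; lia.
rewrite sumrB -!PS => H; apply/eqP; rewrite -eqz_nat [X in X == _]PoszD [X in _ == X]PoszD !abszE; apply/eqP.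
move: H; rewrite /X /Y; lia.
Qed.
End TanakaSum.

Section NatExpectation.
Context d (T : measurableType d) (R : realType) (mu : {measure set T -> \bar R}).
Implicit Types (f g : T -> nat) (b : T -> bool).
Local Open Scope ereal_scope.

Definition natexp f : \bar R := \int[mu]_c ((f c)%:R)%:E.

Lemma measurable_natR f : measurable_fun setT f -> measurable_fun setT (fun c => ((f c)%:R)%:E : \bar R).
Proof. by move=> mf; apply: (measurable_fun_discrete (fun n => (n%:R)%:E : \bar R)). Qed.

Lemma natexp_ge0 f : 0 <= natexp f.
Proof. by apply: integral_ge0 => c _; rewrite lee_fin. Qed.

Lemma natexpD f g : measurable_fun setT f -> measurable_fun setT g ->
  natexp (fun c => f c + g c)%N = natexp f + natexp g.
Proof.
move=> mf mg; rewrite /natexp -ge0_integralD//; try by move=> c _; rewrite lee_fin.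
- by apply: eq_integral => c _; rewrite natrD EFinD.
- exact: measurable_natR.
- exact: measurable_natR.
Qed.

Lemma natexp_sum (I : Type) (s : seq I) (f : I -> T -> nat) :
  (forall i, measurable_fun setT (f i)) ->
  natexp (fun c => \sum_(i <- s) f i c)%N = \sum_(i <- s) natexp (f i).
Proof.
move=> mf; elim: s => [|i s ih].
  by under [LHS]eq_integral => c _ do rewrite big_nil; rewrite integral0 big_nil.
rewrite big_cons -ih -natexpD//; last exact: measurable_fun_sumn.
by apply: eq_integral => c _; rewrite big_cons.
Qed.

Lemma natexp_bool b : measurable_fun setT b -> natexp (fun c => b c) = mu [set c | b c].
Proof.
move=> mb; rewrite /natexp.
rewrite (eq_integral (fun c => (\1_[set c | b c] c)%:E)); last first.
  by move=> c _; rewrite indicE; congr ((nat_of_bool _)%:R)%:E; apply/idP/idP; rewrite inE.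
by rewrite integral_indic ?setIT//; exact: measurable_set_bool.
Qed.

Lemma natexpM n f : measurable_fun setT f -> natexp (fun c => n * f c)%N = (n%:R)%:E * natexp f.
Proof.
move=> mf; rewrite /natexp -ge0_integralZl_EFin//; try by move=> c _; rewrite lee_fin.
- by apply: eq_integral => c _; rewrite natrM EFinM.
- exact: measurable_natR.
Qed.

Lemma le_natexp_ae f g : measurable_fun setT f -> measurable_fun setT g ->
  (\forall c \ae mu, (f c <= g c)%N) -> natexp f <= natexp g.
Proof.
move=> mf mg fg; apply: ae_ge0_le_integral => //; try by [exact: measurable_natR|move=> c _; rewrite lee_fin].
- by apply: filterS fg => c h _; rewrite lee_fin ler_nat.
Qed.

Lemma markov_nat f B : measurable_fun setT f ->
  (B.+1%:R)%:E * mu [set c | (B < f c)%N] <= natexp f.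
Proof.
move=> mf.
have mb : measurable_fun setT (fun c => (B < f c)%N).
  exact: (measurable_fun_discrete (fun n => B < n)%N).
rewrite -natexp_bool// -natexpM; last exact: measurable_fun_nat_of_bool.
apply: le_natexp_ae => //.
  by apply: (measurable_fun_discrete (fun n => B.+1 * (B < n))%N).
by apply: aeW => c; case: ltnP => h; rewrite ?muln1 ?muln0.
Qed.

(* A form of Fatou's lemma. *)
Lemma bounded_subsequence_ae (f : nat -> T -> nat) (M : R) :
  mu setT < +oo -> (forall n, measurable_fun setT (f n)) -> (forall n, natexp (f n) <= M%:E) ->
  \forall c \ae mu, exists B, forall N, exists n, (N <= n)%N /\ (f n c <= B)%N.
Proof.
move=> fin mf hM.
pose G B N := \bigcap_(n in [set n | (N <= n)%N]) [set c | (B < f n c)%N].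
have mfn B n : measurable [set c | (B < f n c)%N].
  by apply: measurable_set_bool; apply: (measurable_fun_discrete (fun n => B < n)%N).
have mG B N : measurable (G B N).
  by apply: bigcap_measurable; [exists N => /=|move=> n _].
have mU B : measurable (\bigcup_N G B N) by exact: bigcup_measurable.
(* The sets [G B N] increase with [N], and each lies in a single event [B < f N c], to which
   Markov's inequality applies. *)
have hU B : mu (\bigcup_N G B N) <= (M / B.+1%:R)%:E.
  have nd : nondecreasing_seq (G B).
    by move=> m n mn; apply/subsetPset => c h k /= nk; apply: h => /=; exact: leq_trans nk.
  have cv := nondecreasing_cvg_mu (mu := mu) (mG B) (mU B) nd.
  apply: cvge_le cv; apply: nearW => n /=.
  apply: (@le_trans _ _ (mu [set c | (B < f n c)%N])).
    apply: le_measure; rewrite ?inE//; by move=> c; apply => /=.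
  rewrite EFinM muleC lee_pdivlMl ?ltr0n//.
  exact: le_trans (markov_nat B (mf n)) (hM n).
have mI : measurable (\bigcap_B \bigcup_N G B N) by exact: bigcapT_measurable.
have I0 : mu (\bigcap_B \bigcup_N G B N) = 0.
  apply: (@measure0_le _ _ (fun B => M / B.+1%:R)%R) => //.
    by move=> B; apply: le_trans (hU B); apply: le_measure; rewrite ?inE//; exact: bigcap_inf.
  rewrite -[X in _ --> X](mulr0 M); apply: cvgMl_tmp; exact: cvg_harmonic.
apply: filterS (ae_measure0 mI I0) => c hc.
apply: contrapT => /forallNP hB; apply: hc => B _.
have /existsNP[N /forallNP hN] := hB B.
exists N => // n /= Nn; have := hN n; rewrite ltnNge => h; apply/negP => le; exact: h.
Qed.
End NatExpectation.

Section Balance.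
Variables (R : realType) (V : countType) (nbrs : V -> seq V).
Local Notation C := (config R V).
Implicit Types (c : C) (x y : V) (k K : nat) (t : R) (e : V * nat).

Definition fired c e t : bool := fires nbrs c e.1 e.2 && (rt c e.1 e.2 <= t).

(* Simultaneous rings are ordered by an arbitrary enumeration of the events. *)
Definition before c e' e : bool :=
  (rt c e'.1 e'.2 < rt c e.1 e.2) ||
  ((rt c e'.1 e'.2 == rt c e.1 e.2) && (pickle e' < pickle e)%N).

Definition events K x : seq (V * nat) := [seq (y, k) | y <- nbrs x, k <- iota 0 K].

Definition arrivals (Z : C -> V -> nat -> V) K t x c : nat :=
  (\sum_(e <- events K x) (fired c e t && (Z c e.1 e.2 == x)))%N.

Definition arrivals_before (Z : C -> V -> nat -> V) K t x e c : nat :=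
  (\sum_(e' <- events K x) [&& before c e' e, fired c e' t & Z c e'.1 e'.2 == x])%N.

(** Departures do not occur: a firing at [x] removes one oil and one water, which cancel. *)
Definition balance K t x c : int :=
  (oil c x + arrivals zo K t x c)%N%:Z - (wat c x + arrivals zw K t x c)%N%:Z.

Definition balance_before K t x e c : int :=
  (oil c x + arrivals_before zo K t x e c)%N%:Z - (wat c x + arrivals_before zw K t x e c)%N%:Z.

Definition visits K t x (m : int) c : nat :=
  (\sum_(e <- events K x) (fired c e t && (balance_before K t x e c == m)))%N.

Lemma before_irr c : irreflexive (before c).
Proof. by move=> e; rewrite /before ltxx ltnn andbF. Qed.

Lemma before_trans c : transitive (before c).
Proof.
move=> e2 e1 e3; rewrite /before => /orP[h1|/andP[/eqP h1 l1]] /orP[h2|/andP[/eqP h2 l2]].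
- by rewrite (lt_trans h1 h2).
- by rewrite -h2 h1.
- by rewrite h1 h2.
- by rewrite h1 h2 eqxx (ltn_trans l1 l2) orbT.
Qed.

Lemma before_total c e e' : e != e' -> before c e e' || before c e' e.
Proof.
move=> ne; rewrite /before; case: ltgtP => //= h.
have : pickle e != pickle e' by apply: contraNneq ne => /(pcan_inj pickleK) ->.
by rewrite neq_ltn.
Qed.

Lemma before_rt c e' e : before c e' e -> rt c e'.1 e'.2 <= rt c e.1 e.2.
Proof. by rewrite /before => /orP[/ltW|/andP[/eqP -> _]]. Qed.

Section Measurability.
Lemma measurable_fired e t : measurable_fun setT (fun c => fired c e t).
Proof.
apply: measurable_and; first exact: measurable_fires.
by apply: measurable_fun_ler => //; exact: measurable_rt.
Qed.

Lemma measurable_before e' e : measurable_fun setT (fun c => before c e' e).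
Proof.
apply: measurable_or.
  by apply: measurable_fun_ltr; exact: measurable_rt.
apply: measurable_and => //.
by apply: measurable_fun_eqr; exact: measurable_rt.
Qed.

Definition measurable_targets (Z : C -> V -> nat -> V) :=
  forall y k x, measurable_fun setT (fun c => Z c y k == x).

Lemma measurable_arrivals Z K t x : measurable_targets Z ->
  measurable_fun setT (arrivals Z K t x).
Proof.
move=> mZ; apply: measurable_fun_sumn => e; apply: measurable_fun_nat_of_bool.
by apply: measurable_and; [exact: measurable_fired|exact: mZ].
Qed.

Lemma measurable_arrivals_before Z K t x e : measurable_targets Z ->
  measurable_fun setT (arrivals_before Z K t x e).
Proof.
move=> mZ; apply: measurable_fun_sumn => e'; apply: measurable_fun_nat_of_bool.
apply: measurable_and; first exact: measurable_before.
by apply: measurable_and; [exact: measurable_fired|exact: mZ].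
Qed.

Lemma measurable_stock (i f : C -> nat) : measurable_fun setT i -> measurable_fun setT f ->
  measurable_fun setT (fun c => i c + f c)%N.
Proof. exact: (measurable_fun_discrete2 addn). Qed.

Lemma measurable_balance_fun d' (U : measurableType d') (g : int -> U) K t x :
  measurable_fun setT (fun c => g (balance K t x c)).
Proof.
apply: (measurable_fun_discrete2 (fun a b => g (a%:Z - b%:Z))); apply: measurable_stock;
  [exact: measurable_oil|apply: measurable_arrivals|exact: measurable_wat|apply: measurable_arrivals].
- by move=> y k z; exact: measurable_zo.
- by move=> y k z; exact: measurable_zw.
Qed.

Lemma measurable_balance_before_fun d' (U : measurableType d') (g : int -> U) K t x e :
  measurable_fun setT (fun c => g (balance_before K t x e c)).
Proof.
apply: (measurable_fun_discrete2 (fun a b => g (a%:Z - b%:Z))); apply: measurable_stock;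
  [exact: measurable_oil|apply: measurable_arrivals_before
  |exact: measurable_wat|apply: measurable_arrivals_before].
- by move=> y k z; exact: measurable_zo.
- by move=> y k z; exact: measurable_zw.
Qed.

Lemma measurable_fired_balance (g : pred int) K t x e :
  measurable_fun setT (fun c => fired c e t && g (balance_before K t x e c)).
Proof.
by apply: measurable_and; [exact: measurable_fired|exact: measurable_balance_before_fun].
Qed.

Lemma measurable_visits K t x m : measurable_fun setT (visits K t x m).
Proof.
apply: measurable_fun_sumn => e; apply: measurable_fun_nat_of_bool.
exact: (measurable_fired_balance (fun z => z == m)).
Qed.
End Measurability.

(** All coordinates but the two jump targets at [e]. They determine the state just before [e] and
    whether [e] fires, so the jump is independent of both. *)
Definition except e : pred (rv_index V) :=
  fun i => match i with
  | inl (inr e') => e' != e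
  | inr e' => e' != e
  | _ => true
  end.

Lemma rt_except c e y k : rt (keep (except e) c) y k = rt c y k.
Proof. exact: rt_keep. Qed.

(** A ring no later than [e] reads only the targets of strictly earlier rings, hence never those of
    [e]. *)
Lemma fires_upto_except n c e y k : rt c y k <= rt c e.1 e.2 ->
  fires_upto nbrs n (keep (except e) c) y k = fires_upto nbrs n c y k.
Proof.
elim: n y k => [//|m ih] y k hk /=.
have hb z j : (rt (keep (except e) c) z j < rt (keep (except e) c) y k)
      && fires_upto nbrs m (keep (except e) c) z j =
    (rt c z j < rt c y k) && fires_upto nbrs m c z j.
  rewrite !rt_except; case: (boolP (_ < _)) => //= hlt.
  by rewrite ih// ltW// (lt_le_trans hlt).
have hne z j : rt c z j < rt c y k -> (z, j) != e.
  by move=> hlt; apply: contraTneq (lt_le_trans hlt hk) => <-; rewrite ltxx.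
congr andb; congr (_ < _ + _)%N; try by apply: eq_bigr => j _; rewrite hb.
all: apply: eq_bigr => z _; apply: eq_bigr => j _; rewrite hb.
all: by case: (boolP (rt c z j < rt c y k)) => //= /hne ->.
Qed.

Lemma fires_except c e y k : rt c y k <= rt c e.1 e.2 ->
  fires nbrs (keep (except e) c) y k = fires nbrs c y k.
Proof.
move=> h; rewrite /fires; congr asbool; apply/propext; split=> -[N hN]; exists N => n /hN;
  by rewrite fires_upto_except.
Qed.

(** An event simultaneous with [e] may come before it in the enumeration; this is why [fires_except]
    allows equal times. *)
Lemma fired_balance_except (g : pred int) K t x e c :
  fired (keep (except e) c) e t && g (balance_before K t x e (keep (except e) c)) =
  fired c e t && g (balance_before K t x e c).
Proof.
have hb e' : before (keep (except e) c) e' e = before c e' e by rewrite /before !rt_except.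
have hne e' : before c e' e -> e' != e.
  by apply: contraTneq => ->; rewrite before_irr.
have hf e' : before c e' e -> fired (keep (except e) c) e' t = fired c e' t.
  by move=> /before_rt h; rewrite /fired rt_except fires_except.
congr (_ && g _); first by rewrite /fired rt_except fires_except.
congr (_%:Z - _%:Z); congr (_ + _)%N; apply: eq_bigr => e' _; rewrite hb;
  case: (boolP (before c e' e)) => //= h; rewrite hf//; congr (nat_of_bool (_ && _)).
all: by case: e' h {hf} => y k /hne /=; rewrite /iZO /iZW /= => ->.
Qed.
End Balance.

Section Expectations.
Variables (R : realType) (V : countType) (nbrs : V -> seq V) (nu : nat -> R).
Local Notation C := (config R V).
Implicit Types (c : C) (x y : V) (k K : nat) (t : R) (e : V * nat).
Hypothesis nbrs_simple : simple_graph nbrs.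
Hypothesis nbrs_transitive : vertex_transitive nbrs.
Variables (D : nat).
Hypothesis degD : forall x, size (nbrs x) = D.
Hypothesis D_gt1 : (1 < D)%N.
Variable Q : probability C R.
Hypothesis Qlaw : oil_water_law nbrs nu Q.
Local Open Scope ereal_scope.

Let p : R := D%:R^-1.

Let p_gt0 : (0 < p)%R.
Proof. by rewrite invr_gt0 ltr0n ltnW. Qed.

Let p_lt1 : (p < 1)%R.
Proof. by rewrite invf_lt1 ?ltr1n// ltr0n ltnW. Qed.

(** The probability that the oil jumps to a given neighbour and the water does not. It is half the
    probability that the balance there moves, a sufficient lower bound. *)
Definition split_prob : R := (p * (1 - p))%R.

Lemma split_prob_gt0 : (0 < split_prob)%R.
Proof. by rewrite mulr_gt0// subr_gt0. Qed.

Section Targets.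
Variables (b : C -> bool) (e : V * nat) (x : V).
Hypotheses (mb : measurable_fun setT b) (be : forall c, b (keep (except e) c) = b c).
(** Encodes that the site of [e] is a neighbour of [x], in the shape of membership in [events]. *)
Hypothesis ex : e \in [seq (y, k) | y <- nbrs x, k <- iota 0 e.2.+1].

Let x_nbr : x \in nbrs e.1.
Proof.
have [_ [sym _]] := nbrs_simple.
by case/allpairsPdep: ex => y [k [yx _ ->]] /=; rewrite -sym.
Qed.

Let mzo : measurable [set c : C | zo c e.1 e.2 == x].
Proof. by apply: measurable_set_bool; exact: measurable_zo. Qed.

Let mzw : measurable [set c : C | zw c e.1 e.2 == x].
Proof. by apply: measurable_set_bool; exact: measurable_zw. Qed.

Let Qzo : Q [set c : C | zo c e.1 e.2 == x] = p%:E.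
Proof.
rewrite (_ : [set c | _] = [set c : C | zo c e.1 e.2 = x]).
  by rewrite (law_zo Qlaw) x_nbr degD.
by apply/seteqP; split=> c /= /eqP.
Qed.

Let Qzw : Q [set c : C | zw c e.1 e.2 == x] = p%:E.
Proof.
rewrite (_ : [set c | _] = [set c : C | zw c e.1 e.2 = x]).
  by rewrite (law_zw Qlaw) x_nbr degD.
by apply/seteqP; split=> c /= /eqP.
Qed.

Let indep_event (A : set C) : measurable A -> keep (predC (except e)) @^-1` A = A ->
  Q ([set c | b c] `&` A) = Q [set c | b c] * Q A.
Proof.
move=> mA eA; apply: (independent_blocks (law_indep Qlaw) (J := except e)) => //.
  exact: measurable_set_bool.
by apply/seteqP; split=> c /=; rewrite be.
Qed.

Let zo_dep c : zo (keep (predC (except e)) c) e.1 e.2 = zo c e.1 e.2.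
Proof. by case: (e) => y k /=; rewrite eqxx. Qed.

Let zw_dep c : zw (keep (predC (except e)) c) e.1 e.2 = zw c e.1 e.2.
Proof. by case: (e) => y k /=; rewrite eqxx. Qed.

Lemma prob_oil_target : Q [set c | b c && (zo c e.1 e.2 == x)] = Q [set c | b c] * p%:E.
Proof.
rewrite -Qzo -indep_event//; last by apply/funext => c; rewrite /preimage /mkset zo_dep.
by congr (Q _); apply/seteqP; split=> c /= => [/andP|[-> ->]].
Qed.

Lemma prob_wat_target : Q [set c | b c && (zw c e.1 e.2 == x)] = Q [set c | b c] * p%:E.
Proof.
rewrite -Qzw -indep_event//; last by apply/funext => c; rewrite /preimage /mkset zw_dep.
by congr (Q _); apply/seteqP; split=> c /= => [/andP|[-> ->]].
Qed.

Lemma prob_split_target :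
  Q [set c | b c] * split_prob%:E <=
  Q [set c | b c && ((zo c e.1 e.2 == x) != (zw c e.1 e.2 == x))].
Proof.
pose A := [set c : C | zo c e.1 e.2 == x] `&` ~` [set c : C | zw c e.1 e.2 == x].
have mA : measurable A by apply: measurableI => //; exact: measurableC.
have QA : Q A = split_prob%:E.
  have nzw : Q (~` [set c : C | zw c e.1 e.2 == x]) = (1 - p)%:E.
    by rewrite probability_setC// Qzw EFinB.
  rewrite /split_prob EFinM -Qzo -nzw.
  apply: (independent_blocks (law_indep Qlaw)
    (J := fun i => if i is inl (inr _) then true else false)) => //.
  exact: measurableC.
rewrite -QA -indep_event//.
  apply: le_measure; rewrite ?inE.
  - by apply: measurableI => //; exact: measurable_set_bool.
  - apply: measurable_set_bool; apply: measurable_and => //.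
    have -> : (fun c => (zo c e.1 e.2 == x) != (zw c e.1 e.2 == x)) =
        (fun c => ((zo c e.1 e.2 == x) && ~~ (zw c e.1 e.2 == x)) ||
                  (~~ (zo c e.1 e.2 == x) && (zw c e.1 e.2 == x))).
      by apply/funext => c; case: (_ == x); case: (_ == x).
    by apply: measurable_or; apply: measurable_and; try apply: measurable_neg;
      by [exact: measurable_zo|exact: measurable_zw].
  - by move=> c /= [-> [-> /negP/negbTE ->]].
by apply/funext => c; rewrite /A /preimage /setI /setC /mkset zo_dep zw_dep.
Qed.
End Targets.

Lemma events_last K x e : e \in events nbrs K x ->
  e \in [seq (y, k) | y <- nbrs x, k <- iota 0 e.2.+1].
Proof.
move=> /allpairsPdep[y [k [yx _ ->]]]; apply/allpairsPdep; exists y, k; split=> //.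
by rewrite mem_iota /=.
Qed.

Lemma events_uniq K x : uniq (events nbrs K x).
Proof.
have [un _] := nbrs_simple.
by apply: allpairs_uniq; rewrite ?iota_uniq// => -[a b] [a' b'] _ _ [-> ->].
Qed.

Lemma Q_fin_bool (b : C -> bool) : measurable_fun setT b -> Q [set c | b c] \is a fin_num.
Proof. by move=> mb; apply: fin_num_measure; exact: measurable_set_bool. Qed.

(** The expectation of [tanaka]. Both targets are uniform and independent of the past, so the terms
    above and below the level have the same expectation on the two sides. The level term remains,
    and the initial distance to [m] is dropped as nonnegative. *)
Lemma visits_le K t x m :
  split_prob%:E * natexp Q (visits nbrs K t x m) <=
  natexp Q (fun c => `|(balance nbrs K t x c - m)%R|%N).
Proof.
pose above e c := fired nbrs c e t && (m < balance_before nbrs K t x e c)%R.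
pose below e c := fired nbrs c e t && (balance_before nbrs K t x e c < m)%R.
pose level e c := fired nbrs c e t && (balance_before nbrs K t x e c == m).
pose zoe e c := zo c e.1 e.2 == x.
pose zwe e c := zw c e.1 e.2 == x.
have mabove e : measurable_fun setT (above e).
  exact: (measurable_fired_balance _ (fun z => (m < z)%R)).
have mbelow e : measurable_fun setT (below e).
  exact: (measurable_fired_balance _ (fun z => (z < m)%R)).
have mlevel e : measurable_fun setT (level e).
  exact: (measurable_fired_balance _ (fun z => z == m)).
have mzoe e : measurable_fun setT (zoe e) by exact: measurable_zo.
have mzwe e : measurable_fun setT (zwe e) by exact: measurable_zw.
have mdiff e : measurable_fun setT (fun c => zoe e c != zwe e c).
  have -> : (fun c => zoe e c != zwe e c) =
      (fun c => (zoe e c && ~~ zwe e c) || (~~ zoe e c && zwe e c)).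
    by apply/funext => c; case: (zoe e c); case: (zwe e c).
  by apply: measurable_or; apply: measurable_and => //; exact: measurable_neg.
have mN (b b' : C -> bool) : measurable_fun setT b -> measurable_fun setT b' ->
    measurable_fun setT (fun c => (b c && b' c : nat)).
  by move=> h h'; apply: measurable_fun_nat_of_bool; exact: measurable_and.
pose X e c := ((above e c && zwe e c) + (below e c && zoe e c))%N.
pose Y e c := ((above e c && zoe e c) + (below e c && zwe e c))%N.
pose Z e c : nat := level e c && (zoe e c != zwe e c).
have mX e : measurable_fun setT (X e) by apply: measurable_stock; exact: mN.
have mY e : measurable_fun setT (Y e) by apply: measurable_stock; exact: mN.
have mZ e : measurable_fun setT (Z e) by exact: mN.
have pathwise c : (`|(balance nbrs K t x c - m)%R| + \sum_(e <- events nbrs K x) X e c =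
    `|((oil c x)%:Z - (wat c x)%:Z - m)%R| + \sum_(e <- events nbrs K x) (Y e c + Z e c))%N.
  exact: (tanaka (@before_irr R V c) (@before_trans R V c) (@before_total R V c)
    (fun e => fired nbrs c e t) (fun e => zoe e c) (fun e => zwe e c)
    (oil c x) (wat c x) m (events_uniq K x)).
have mbal : measurable_fun setT (fun c => `|(balance nbrs K t x c - m)%R|%N).
  exact: (measurable_balance_fun _ (fun z => `|(z - m)%R|%N)).
have m0 : measurable_fun setT (fun c => `|((oil c x)%:Z - (wat c x)%:Z - m)%R|%N).
  apply: (measurable_fun_discrete2 (fun a b => `|(a%:Z - b%:Z - m)%R|%N)).
    exact: measurable_oil.
  exact: measurable_wat.
have Qo e (b : C -> bool) : e \in events nbrs K x -> measurable_fun setT b ->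
    (forall c, b (keep (except e) c) = b c) ->
    Q [set c | b c && zoe e c] = Q [set c | b c] * p%:E.
  by move=> /events_last eE mb be; exact: prob_oil_target.
have Qw e (b : C -> bool) : e \in events nbrs K x -> measurable_fun setT b ->
    (forall c, b (keep (except e) c) = b c) ->
    Q [set c | b c && zwe e c] = Q [set c | b c] * p%:E.
  by move=> /events_last eE mb be; exact: prob_wat_target.
have dabove e c : above e (keep (except e) c) = above e c.
  exact: (fired_balance_except nbrs (fun z => (m < z)%R)).
have dbelow e c : below e (keep (except e) c) = below e c.
  exact: (fired_balance_except nbrs (fun z => (z < m)%R)).
have Ebool (b b' : C -> bool) : measurable_fun setT b -> measurable_fun setT b' ->
    natexp Q (fun c => (b c && b' c : nat)) = Q [set c | b c && b' c].
  by move=> h h'; apply: (@natexp_bool _ _ _ Q (fun c => b c && b' c)); exact: measurable_and.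
have sX : natexp Q (fun c => \sum_(e <- events nbrs K x) X e c)%N =
    \sum_(e <- events nbrs K x) (Q [set c | above e c] * p%:E + Q [set c | below e c] * p%:E).
  rewrite natexp_sum//; rewrite big_seq [RHS]big_seq; apply: eq_bigr => e eE.
  rewrite -(Qw e (above e))// -(Qo e (below e))// -!Ebool//.
  by apply: natexpD; exact: mN.
have sY : natexp Q (fun c => \sum_(e <- events nbrs K x) Y e c)%N =
    \sum_(e <- events nbrs K x) (Q [set c | above e c] * p%:E + Q [set c | below e c] * p%:E).
  rewrite natexp_sum//; rewrite big_seq [RHS]big_seq; apply: eq_bigr => e eE.
  rewrite -(Qo e (above e))// -(Qw e (below e))// -!Ebool//.
  by apply: natexpD; exact: mN.
(* The truncation at [K] makes this a finite sum of probabilities, so it can be subtracted from both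
   sides. *)
have Sfin : natexp Q (fun c => \sum_(e <- events nbrs K x) X e c)%N \is a fin_num.
  rewrite sX; apply/sum_fin_numP => e _ _.
  by rewrite fin_numD !fin_numM// ?Q_fin_bool.
have E1 : natexp Q (fun c => `|(balance nbrs K t x c - m)%R|%N) +
      natexp Q (fun c => \sum_(e <- events nbrs K x) X e c)%N =
    (natexp Q (fun c => `|((oil c x)%:Z - (wat c x)%:Z - m)%R|%N) +
     natexp Q (fun c => \sum_(e <- events nbrs K x) Z e c)%N) +
      natexp Q (fun c => \sum_(e <- events nbrs K x) X e c)%N.
  rewrite -natexpD//; last exact: measurable_fun_sumn.
  rewrite sX -sY -addeA [_ + natexp _ _]addeC -[in RHS]natexpD; try exact: measurable_fun_sumn.
  rewrite -natexpD//; last by apply: measurable_stock; exact: measurable_fun_sumn.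
  by congr natexp; apply/funext => c; rewrite pathwise big_split.
have sZ : split_prob%:E * natexp Q (visits nbrs K t x m) <=
    natexp Q (fun c => \sum_(e <- events nbrs K x) Z e c)%N.
  have -> : natexp Q (visits nbrs K t x m) =
      \sum_(e <- events nbrs K x) natexp Q (fun c => (level e c : nat)).
    by apply: (@natexp_sum _ _ _ Q _ _ (fun e c => (level e c : nat))) => e; exact: measurable_fun_nat_of_bool (mlevel e).
  rewrite [leRHS]natexp_sum//.
  rewrite ge0_sume_distrr; last by move=> e _; exact: natexp_ge0.
  rewrite big_seq [leRHS]big_seq; apply: lee_sum => e eE.
  rewrite (@natexp_bool _ _ _ Q (level e))// (Ebool (level e) (fun c => zoe e c != zwe e c))//.
  rewrite muleC; apply: (@prob_split_target (level e) e x) => //; last exact: (events_last eE).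
  by move=> c; exact: (fired_balance_except nbrs (fun z => z == m)).
apply: le_trans sZ _.
have := congr1 (fun z => z - natexp Q (fun c => \sum_(e <- events nbrs K x) X e c)%N) E1.
rewrite !addeK// => ->.
by rewrite leeDr// natexp_ge0.
Qed.
End Expectations.

(** * Bound on the expected balance *)

(** Each of [r^0], ..., [r^(n-1)] is at least [r^n], so [n r^n (1 - r)] is at most [1 - r^n]; the
    induction carries this stronger form. *)
Lemma natr_expr_le (R : realType) (r : R) n : 0 <= r -> r <= 1 ->
  (1 - r) * (n%:R * r ^+ n) <= 1.
Proof.
move=> r0 r1; suff : (1 - r) * (n%:R * r ^+ n) + r ^+ n <= 1.
  by apply: le_trans; rewrite lerDl exprn_ge0.
elim: n => [|n ih]; first by rewrite mul0r mulr0 add0r expr0.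
have rn : r ^+ n <= 1 by rewrite exprn_ile1.
have rn0 : 0 <= r ^+ n by rewrite exprn_ge0.
rewrite exprS -natr1.
have -> : (1 - r) * ((n%:R + 1) * (r * r ^+ n)) + r * r ^+ n =
  r * ((1 - r) * (n%:R * r ^+ n) + r ^+ n) + (1 - r) * (r * r ^+ n) by ring.
have h1 : r * ((1 - r) * (n%:R * r ^+ n) + r ^+ n) <= r * 1 by rewrite ler_wpM2l.
have h2 : (1 - r) * (r * r ^+ n) <= (1 - r) * 1.
  by rewrite ler_wpM2l ?subr_ge0// -exprS exprn_ile1.
lra.
Qed.

Lemma natr_expr_small (R : realType) (r e : R) n : 0 <= r -> r < 1 -> 0 < e ->
  exists K, (n <= K)%N /\ K%:R * r ^+ K.+1 <= e.
Proof.
move=> r0 r1 e0.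
have cv : (fun j => 2 / (1 - r) * r ^+ j) @ \oo --> (0 : R).
  rewrite -[X in _ --> X](mulr0 (2 / (1 - r))); apply: cvgMl_tmp.
  by apply: cvg_expr; rewrite ger0_norm.
have [N _ hN] := cvgr_lt _ cv _ e0.
have := hN (maxn n N) (leq_maxr _ _) => /=; set j := maxn n N => hj.
(* With [K = 2j], one factor [r^j] absorbs the factor [K] by [natr_expr_le], and the other one is
   small. *)
exists (j.*2); split; first by rewrite (leq_trans (leq_maxl n N))// -addnn leq_addr.
apply: ltW; apply: le_lt_trans hj.
rewrite -addnn exprS exprD natrD.
have d0 : 0 < 1 - r by rewrite subr_gt0.
have hb : j%:R * r ^+ j <= (1 - r)^-1.
  by rewrite -[leRHS]mulr1 ler_pdivlMl//; apply: natr_expr_le => //; exact: ltW.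
have rj : 0 <= r ^+ j by rewrite exprn_ge0.
have -> : (j%:R + j%:R) * (r * (r ^+ j * r ^+ j)) = r * (2 * (j%:R * r ^+ j) * r ^+ j) by ring.
apply: (@le_trans _ _ (1 * (2 * (j%:R * r ^+ j) * r ^+ j))).
  by rewrite ler_wpM2r ?(ltW r1)// !mulr_ge0.
by rewrite mul1r ler_wpM2r// ler_wpM2l.
Qed.

Lemma natexp_le_series d (T : measurableType d) (R : realType) (mu : {measure set T -> \bar R})
    (f : T -> nat) : measurable_fun setT f ->
  (natexp mu f <= \sum_(n <oo) ((n%:R)%:E * mu [set c | f c = n]))%E.
Proof.
move=> mf.
have mE n : measurable_fun setT (fun c => (n * (f c == n))%N).
  exact: (measurable_fun_discrete (fun k => n * (k == n))%N).
have mb n : measurable_fun setT (fun c => f c == n).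
  exact: (measurable_fun_discrete (fun k => k == n)).
apply: (@le_trans _ _ (\int[mu]_c \sum_(n <oo) ((n * (f c == n))%N%:R)%:E)%E).
  apply: ge0_le_integral => //; try by [exact: measurable_natR|move=> c _; rewrite lee_fin
    |move=> c _; apply: nneseries_ge0 => n _ _; rewrite lee_fin
    |apply: ge0_emeasurable_sum => n; [move=> c _ _; rewrite lee_fin|move=> _; exact: measurable_natR]].
  move=> c _; apply: le_trans (nneseries_lim_ge (f c).+1 _); last by move=> n _ _; rewrite lee_fin.
  by rewrite big_nat_recr//= eqxx muln1 leeDr// sume_ge0// => n _; rewrite lee_fin.
have -> : (\int[mu]_c \sum_(n <oo) ((n * (f c == n))%N%:R)%:E =
    \sum_(n <oo) natexp mu (fun c => n * (f c == n))%N)%E.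
  by apply: integral_nneseries => //; try (move=> n; exact: measurable_natR).
apply: lee_nneseries => n _; first by move=> _; exact: natexp_ge0.
rewrite (natexpM mu n (measurable_fun_nat_of_bool (mb n))) (natexp_bool mu (mb n)).
rewrite (_ : [set c | f c == n] = [set c | f c = n])//.
by apply/seteqP; split=> c /= /eqP.
Qed.

Section Mass.
Variables (R : realType) (V : countType) (nbrs : V -> seq V).
Local Notation C := (config R V).
Implicit Types (c : C) (x y : V) (k K : nat) (t : R) (e : V * nat).

Definition departures K t x c : nat := (\sum_(k <- iota 0 K) fired nbrs c (x, k) t)%N.
(** Indices start at 0: these are the neighbours that ring more than [K] times by time [t], some of
    whose firings the truncation may miss. *)
Definition late K t x c : nat := (\sum_(y <- nbrs x) (rt c y K <= t)%R)%N.

Lemma sum_events K x (F : V * nat -> nat) :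
  (\sum_(e <- events nbrs K x) F e = \sum_(y <- nbrs x) \sum_(j < K) F (y, nat_of_ord j))%N.
Proof.
rewrite /events big_allpairs_dep; apply: eq_bigr => y _.
by rewrite -[iota 0 K]/(iota 0 _) -{1}[K]subn0 -/(index_iota 0 K) big_mkord.
Qed.

(** If a neighbour is late, the last summand is at least [K] and hence bounds the departures.
    Otherwise all arrivals up to [t] are counted, and at the last counted firing [x] still held a
    particle of each type. *)
Lemma departures_le c K t x : good nbrs c ->
  (departures K t x c <= oil c x + arrivals nbrs zo K t x c + K * late K t x c)%N /\
  (departures K t x c <= wat c x + arrivals nbrs zw K t x c + K * late K t x c)%N.
Proof.
move=> gc.
have depE : departures K t x c = (\sum_(j < K) fired nbrs c (x, nat_of_ord j) t)%N.
  by rewrite /departures -{1}[K]subn0 -/(index_iota 0 K) big_mkord.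
have depK : (departures K t x c <= K)%N.
  rewrite depE (leq_trans (n := \sum_(j < K) 1)%N)//; first by apply: leq_sum => j _; exact: leq_b1.
  by rewrite sum1_card card_ord.
have [l0|] := posnP (late K t x c); last first.
  move=> l0; split; apply: (leq_trans depK); apply: (leq_trans _ (leq_addl _ _));
    by rewrite leq_pmulr.
have late_gt y : y \in nbrs x -> t < rt c y K.
  move=> yx; move/eqP: l0; rewrite /late sum_nat_seq_eq0 => /allP/(_ _ yx) /=.
  by rewrite eqb0 -ltNge.
rewrite l0 muln0 !addn0.
have [[k0 hk0]|no] := pselect (exists k, (k < K)%N && fired nbrs c (x, k) t); last first.
  suff -> : departures K t x c = 0%N by [].
  rewrite depE big1// => j _; apply/eqP; rewrite eqb0; apply/negP => h.
  by apply: no; exists j; rewrite ltn_ord.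
have ex : exists k, (k < K)%N && fired nbrs c (x, k) t by exists k0.
have ub k : (k < K)%N && fired nbrs c (x, k) t -> (k <= K)%N by move=> /andP[/ltnW].
have [k /andP[kK fk] kmax] := ex_maxnP ex ub.
have /andP[ffk tk] := fk.
have hlt y j : y \in x :: nbrs x -> (K <= j)%N -> rt c x k < rt c y j.
  rewrite inE => /orP[/eqP ->|yx] Kj; first by apply: (rt_lt gc); exact: leq_trans Kj.
  apply: (le_lt_trans tk); apply: (lt_le_trans (late_gt _ yx)); exact: (rt_le gc).
have [fcan _] := fires_spec gc (x, k).
move: ffk; rewrite fcan /= (can_fireE _ hlt (leqnn K)) => /andP[ho hw].
have dep_le : (departures K t x c <=
    (\sum_(j < K) ((rt c x j < rt c x k)%R && fires nbrs c x j)).+1)%N.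
  rewrite depE -addn1.
  have -> : 1%N = (\sum_(j < K) (nat_of_ord j == k))%N.
    rewrite (bigD1 (Ordinal kK))//= eqxx big1 ?addn0// => j /eqP jk; apply/eqP; rewrite eqb0.
    by apply/eqP => e; apply: jk; exact: val_inj.
  rewrite -big_split /=; apply: leq_sum => j _.
  case: (boolP (fired nbrs c (x, nat_of_ord j) t)) => //= hj.
  have := kmax j; rewrite ltn_ord hj => /(_ isT); rewrite leq_eqVlt => /orP[/eqP -> |jk].
    by rewrite eqxx addn1.
  by rewrite (rt_lt gc)//; move: hj => /andP[/= -> _].
have arr (Z : C -> V -> nat -> V) : (\sum_(y <- nbrs x) \sum_(j < K)
     (((rt c y j < rt c x k)%R && fires nbrs c y j) && (Z c y j == x)) <= arrivals nbrs Z K t x c)%N.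
  rewrite /arrivals sum_events; apply: leq_sum => y _; apply: leq_sum => j _.
  rewrite /fired /=; case: (boolP (rt c y j < rt c x k)) => //= h.
  by rewrite (le_trans (ltW h) tk) andbT.
split; apply: (leq_trans dep_le).
  by apply: (leq_trans ho); rewrite leq_add2l; exact: (arr zo).
by apply: (leq_trans hw); rewrite leq_add2l; exact: (arr zw).
Qed.
End Mass.

Section MassBound.
Variables (R : realType) (V : countType) (nbrs : V -> seq V) (nu : nat -> R).
Local Notation C := (config R V).
Implicit Types (c : C) (x y : V) (k K : nat) (t : R) (e : V * nat).
Hypothesis nbrs_simple : simple_graph nbrs.
Hypothesis nbrs_transitive : vertex_transitive nbrs.
Variables (D : nat).
Hypothesis degD : forall x, size (nbrs x) = D.
Hypothesis D_gt1 : (1 < D)%N.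
Variable Q : probability C R.
Hypothesis Qlaw : oil_water_law nbrs nu Q.
Hypothesis Qgood : \forall c \ae Q, good nbrs c.
Variable mean : R.
Hypothesis mean_oil : forall x, (natexp Q (fun c => oil c x) <= mean%:E)%E.
Hypothesis mean_wat : forall x, (natexp Q (fun c => wat c x) <= mean%:E)%E.
Local Open Scope ereal_scope.

Let nbrs_uniq : forall x, uniq (nbrs x).
Proof. by have [] := nbrs_simple. Qed.

Let p : R := D%:R^-1.

Lemma measurable_departures K t x : measurable_fun setT (departures nbrs K t x).
Proof. by apply: measurable_fun_sumn => k; apply: measurable_fun_nat_of_bool; exact: measurable_fired. Qed.

Lemma measurable_late K t x : measurable_fun setT (@late R V nbrs K t x).
Proof.
apply: measurable_fun_sumn => y; apply: measurable_fun_nat_of_bool.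
by apply: measurable_fun_ler => //; exact: measurable_rt.
Qed.

Lemma fired_transitive x y k t :
  Q [set c | fired nbrs c (y, k) t] = Q [set c | fired nbrs c (x, k) t].
Proof.
apply: (law_transitive nbrs_uniq nbrs_transitive Qlaw (A := fun y => [set c | fired nbrs c (y, k) t])).
  by move=> z; apply: measurable_set_bool; exact: measurable_fired.
move=> phi psi phiK psiK adj z; apply/funext => c.
by rewrite /preimage /mkset /fired (fires_pull nbrs_uniq phiK psiK adj).
Qed.

Lemma sum_const (I : Type) (s : seq I) (a : \bar R) : 0 <= a ->
  \sum_(i <- s) a = ((size s)%:R)%:E * a.
Proof.
move=> a0; elim: s => [|i s ih]; first by rewrite big_nil mul0e.
by rewrite big_cons ih /= -natr1 EFinD ge0_muleDl ?lee_fin// mul1e addeC.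
Qed.

(* Transitivity balances the expected flows in and out of a site. *)
Lemma natexp_arrivals (Z : C -> V -> nat -> V) K t x : measurable_targets Z ->
  (forall e, e \in events nbrs K x ->
    Q [set c | fired nbrs c e t && (Z c e.1 e.2 == x)] = Q [set c | fired nbrs c e t] * p%:E) ->
  natexp Q (arrivals nbrs Z K t x) = natexp Q (departures nbrs K t x).
Proof.
move=> mZ hZ.
have mf e : measurable_fun setT (fun c => fired nbrs c e t) by exact: measurable_fired.
have -> : natexp Q (arrivals nbrs Z K t x) =
    \sum_(e <- events nbrs K x) Q [set c | fired nbrs c (x, e.2) t] * p%:E.
  have -> : natexp Q (arrivals nbrs Z K t x) = \sum_(e <- events nbrs K x)
      natexp Q (fun c => (fired nbrs c e t && (Z c e.1 e.2 == x) : nat)).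
    apply: (@natexp_sum _ _ _ Q _ _ (fun e c => (fired nbrs c e t && (Z c e.1 e.2 == x) : nat))).
    by move=> e; apply: measurable_fun_nat_of_bool; apply: measurable_and.
  rewrite big_seq [RHS]big_seq; apply: eq_bigr => e eE.
  rewrite (@natexp_bool _ _ _ Q (fun c => fired nbrs c e t && (Z c e.1 e.2 == x))); last exact: measurable_and.
  apply: (etrans (hZ e eE)).
  by case: e {eE} => y k; rewrite (fired_transitive x).
have -> : natexp Q (departures nbrs K t x) = \sum_(k <- iota 0 K) Q [set c | fired nbrs c (x, k) t].
  have -> : natexp Q (departures nbrs K t x) = \sum_(k <- iota 0 K) natexp Q (fun c => (fired nbrs c (x, k) t : nat)).
    apply: (@natexp_sum _ _ _ Q _ _ (fun k c => (fired nbrs c (x, k) t : nat))).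
    by move=> k; exact: measurable_fun_nat_of_bool.
  by apply: eq_bigr => k _; rewrite (@natexp_bool _ _ _ Q (fun c => fired nbrs c (x, k) t)).
rewrite /events big_allpairs_dep /=.
rewrite sum_const; last by apply: sume_ge0 => k _; rewrite mule_ge0// lee_fin invr_ge0.
rewrite degD -ge0_sume_distrl// muleCA -EFinM mulfV ?mule1// pnatr_eq0 -lt0n.
exact: ltnW.
Qed.

(** The signed stock [S] satisfies [S >= - K * late], hence [|S| <= S + 2 * K * late]. In the
    expectation of [S], arrivals and departures cancel. *)
Lemma natexp_displacement (i : C -> nat) (Z : C -> V -> nat -> V) K t x :
  measurable_fun setT i -> natexp Q i <= mean%:E -> measurable_targets Z ->
  (forall e, e \in events nbrs K x ->
    Q [set c | fired nbrs c e t && (Z c e.1 e.2 == x)] = Q [set c | fired nbrs c e t] * p%:E) ->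
  (\forall c \ae Q, (departures nbrs K t x c <= i c + arrivals nbrs Z K t x c + K * late nbrs K t x c)%N) ->
  natexp Q (fun c => `|((i c + arrivals nbrs Z K t x c)%N%:Z - (departures nbrs K t x c)%:Z)%R|%N)
  <= mean%:E + ((2 * K)%N%:R)%:E * natexp Q (late nbrs K t x).
Proof.
move=> mi hi mZ hZ hd.
have md := measurable_departures K t x.
have ma : measurable_fun setT (arrivals nbrs Z K t x) by exact: measurable_arrivals.
have ml := measurable_late K t x.
have mia := measurable_stock mi ma.
have mabs : measurable_fun setT (fun c =>
    `|((i c + arrivals nbrs Z K t x c)%N%:Z - (departures nbrs K t x c)%:Z)%R|%N).
  exact: (measurable_fun_discrete2 (fun a b => `|(a%:Z - b%:Z)%R|%N) mia md).
have mKl : measurable_fun setT (fun c => (2 * K) * late nbrs K t x c)%N.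
  exact: (measurable_fun_discrete (fun n => (2 * K) * n)%N ml).
(* At most [K] departures are counted, so their expectation can be cancelled. *)
have dfin : natexp Q (departures nbrs K t x) \is a fin_num.
  rewrite ge0_fin_numE ?natexp_ge0//; apply: (@le_lt_trans _ _ (\sum_(k <- iota 0 K) 1)).
    have -> : natexp Q (departures nbrs K t x) = \sum_(k <- iota 0 K) natexp Q (fun c => (fired nbrs c (x, k) t : nat)).
      apply: (@natexp_sum _ _ _ Q _ _ (fun k c => (fired nbrs c (x, k) t : nat))).
      by move=> k; apply: measurable_fun_nat_of_bool; exact: measurable_fired.
    apply: lee_sum => k _.
    have mk : measurable_fun setT (fun c => fired nbrs c (x, k) t) by exact: measurable_fired.
    rewrite (@natexp_bool _ _ _ Q (fun c => fired nbrs c (x, k) t))//.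
    by apply: probability_le1; exact: measurable_set_bool.
  by rewrite sum_const// mule1 ltry.
rewrite -(leeD2rE _ _ dfin) -natexpD// -addeA -natexpM//.
rewrite [X in _ <= _ + X]addeC addeA -(natexp_arrivals mZ hZ).
apply: (@le_trans _ _ (natexp Q i + natexp Q (arrivals nbrs Z K t x) +
   natexp Q (fun c => (2 * K) * late nbrs K t x c)%N)); last first.
  by apply: leeD => //; exact: leeD.
rewrite -natexpD// -natexpD//.
apply: le_natexp_ae; [exact: measurable_stock|exact: measurable_stock|].
apply: filterS hd => c; lia.
Qed.

Lemma natexp_late K t x : (0 <= t)%R ->
  natexp Q (late nbrs K t x) <= (D%:R * early_prob t ^+ K.+1)%:E.
Proof.
move=> t0.
have mk y : measurable_fun setT (fun c => (rt c y K <= t)%R).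
  by apply: measurable_fun_ler => //; exact: measurable_rt.
have -> : natexp Q (late nbrs K t x) = \sum_(y <- nbrs x) natexp Q (fun c => ((rt c y K <= t)%R : nat)).
  apply: (@natexp_sum _ _ _ Q _ _ (fun y c => ((rt c y K <= t)%R : nat))).
  by move=> y; exact: measurable_fun_nat_of_bool.
rewrite EFinM -(degD x) -sum_const; last by rewrite lee_fin exprn_ge0// early_prob_ge0.
apply: lee_sum => y _; rewrite (@natexp_bool _ _ _ Q (fun c => (rt c y K <= t)%R))//.
exact: (rt_le_prob Qlaw).
Qed.

(** The balance is the signed stock of oils minus that of waters, with the same departures in both.
    Each of them contributes [mean] and an error of [2 * K] times the expectation of [late]. *)
Lemma natexp_balance K t x (m : int) : (0 <= t)%R ->
  natexp Q (fun c => `|(balance nbrs K t x c - m)%R|%N) <=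
  (2 * mean + 4 * (K%:R * (D%:R * early_prob t ^+ K.+1)) + (`|m|%N)%:R)%:E.
Proof.
move=> t0.
have mzo : measurable_targets (fun c : C => zo c) by move=> y k z; exact: measurable_zo.
have mzw : measurable_targets (fun c : C => zw c) by move=> y k z; exact: measurable_zw.
have mf e : measurable_fun setT (fun c => fired nbrs c e t) by exact: measurable_fired.
have ef e c : fired nbrs (keep (except e) c) e t = fired nbrs c e t.
  by have := fired_balance_except nbrs predT K t x e c; rewrite !andbT.
have dispo := @natexp_displacement (fun c => oil c x) zo K t x (measurable_oil x) (mean_oil x) mzo
  (fun e eE => prob_oil_target nbrs_simple degD Qlaw (mf e) (ef e) (events_last eE)).
have dispw := @natexp_displacement (fun c => wat c x) zw K t x (measurable_wat x) (mean_wat x) mzw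
  (fun e eE => prob_wat_target nbrs_simple degD Qlaw (mf e) (ef e) (events_last eE)).
have {}dispo := dispo (ltac:(apply: filterS Qgood => c gc; exact: (departures_le K t x gc).1)).
have {}dispw := dispw (ltac:(apply: filterS Qgood => c gc; exact: (departures_le K t x gc).2)).
have late_le := natexp_late K x t0.
have md := measurable_departures K t x.
set fo := (fun c => `|_|%N) in dispo; set fw := (fun c => `|_|%N) in dispw.
have mfo : measurable_fun setT fo.
  apply: (measurable_fun_discrete2 (fun a b => `|(a%:Z - b%:Z)%R|%N)) => //.
  by apply: measurable_stock; [exact: measurable_oil|exact: measurable_arrivals].
have mfw : measurable_fun setT fw.
  apply: (measurable_fun_discrete2 (fun a b => `|(a%:Z - b%:Z)%R|%N)) => //.
  by apply: measurable_stock; [exact: measurable_wat|exact: measurable_arrivals].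
have step : natexp Q (fun c => `|(balance nbrs K t x c - m)%R|%N) <=
    natexp Q fo + natexp Q fw + ((`|m|%N)%:R)%:E.
  have -> : ((`|m|%N)%:R)%:E = natexp Q (fun=> `|m|%N).
    rewrite /natexp integral_cst// -[LHS]mule1; congr (_ * _).
    exact/esym/(probability_setT Q).
  rewrite -natexpD// -natexpD//; last exact: measurable_stock.
  apply: le_natexp_ae.
  - exact: (measurable_balance_fun _ (fun z => `|(z - m)%R|%N)).
  - by apply: measurable_stock => //; exact: measurable_stock.
  - by apply: aeW => c; rewrite /fo /fw /balance; lia.
apply: le_trans step _; rewrite EFinD; apply: leeD => //.
have bound (z : \bar R) : z <= mean%:E + ((2 * K)%N%:R)%:E * natexp Q (late nbrs K t x) ->
    z <= (mean + 2 * (K%:R * (D%:R * early_prob t ^+ K.+1)))%:E.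
  move=> /le_trans; apply; rewrite EFinD; apply: leeD => //.
  by rewrite natrM [in leRHS]mulrA [leRHS]EFinM; apply: lee_pmul => //; exact: natexp_ge0.
apply: (le_trans (leeD (bound _ dispo) (bound _ dispw))).
by rewrite -EFinD lee_fin; lra.
Qed.
End MassBound.

(** * Choice of the truncation and boundedness along subsequences of times *)

Section Recurrence.
Variables (R : realType) (V : countType) (nbrs : V -> seq V) (nu : nat -> R).
Local Notation C := (config R V).
Implicit Types (c : C) (x y : V) (k K : nat) (t : R) (e : V * nat).
Hypothesis nbrs_simple : simple_graph nbrs.
Hypothesis nbrs_transitive : vertex_transitive nbrs.
Variables (D : nat).
Hypothesis degD : forall x, size (nbrs x) = D.
Hypothesis D_gt1 : (1 < D)%N.
Variable Q : probability C R.
Hypothesis Qlaw : oil_water_law nbrs nu Q.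
Hypothesis Qgood : \forall c \ae Q, good nbrs c.
Variable mean : R.
Hypothesis mean_oil : forall x, (natexp Q (fun c => oil c x) <= mean%:E)%E.
Hypothesis mean_wat : forall x, (natexp Q (fun c => wat c x) <= mean%:E)%E.

(** The summand [n * late] forces [late] to vanish once [n] exceeds [B]. A bounded balance and an
    exact truncation are thus obtained at the same times. *)
Definition balanced_often (Kn : nat -> nat) x c := exists B, forall N, exists n, (N <= n)%N /\
  (`|balance nbrs (Kn n) n%:R x c|%N + n * late nbrs (Kn n) n%:R x c <= B)%N.

Definition visits_bounded (Kn : nat -> nat) x c := forall m, exists B, forall N, exists n,
  (N <= n)%N /\ (visits nbrs (Kn n) n%:R x m c <= B)%N.

Lemma recurrence_ae : exists Kn : nat -> nat, (forall n, n <= Kn n)%N /\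
  forall x, \forall c \ae Q, balanced_often Kn x c /\ visits_bounded Kn x c.
Proof.
have D0 : 0 < D%:R :> R by rewrite ltr0n ltnW.
(* Makes the error term of [natexp_balance] at most 1. *)
have e0 : 0 < (4 * D%:R)^-1 :> R by rewrite invr_gt0 mulr_gt0.
have [Kn hKn] := @choice _ _ (fun n K => (n <= K)%N /\
    K%:R * early_prob (n%:R : R) ^+ K.+1 <= (4 * D%:R)^-1)
  (fun n => natr_expr_small n (early_prob_ge0 (ler0n R n)) (early_prob_lt1 _) e0).
exists Kn; split; first by move=> n; case: (hKn n).
have small n : 4 * ((Kn n)%:R * (D%:R * early_prob (n%:R : R) ^+ (Kn n).+1)) <= 1.
  have [_ h] := hKn n; have d0 : 0 < 4 * D%:R :> R by rewrite mulr_gt0.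
  rewrite (_ : 4 * _ = (4 * D%:R) * ((Kn n)%:R * early_prob (n%:R : R) ^+ (Kn n).+1)); last by ring.
  by rewrite -[leRHS](mulfV (lt0r_neq0 d0)) ler_pM2l.
have Qfin0 : (Q setT < +oo)%E by rewrite (le_lt_trans (probability_le1 Q _))// ltry.
have bal n x (m : int) : (natexp Q (fun c => `|(balance nbrs (Kn n) n%:R x c - m)%R|%N) <=
    (2 * mean + 1 + (`|m|%N)%:R)%:E)%E.
  apply: le_trans (natexp_balance nbrs_simple nbrs_transitive degD D_gt1 Qlaw Qgood mean_oil mean_wat
    (Kn n) x m (ler0n R n)) _.
  by rewrite lee_fin; have := small n; lra.
move=> x; apply: filterS2 (fun c (h1 : balanced_often Kn x c) (h2 : visits_bounded Kn x c) => conj h1 h2) _ _.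
- apply: (@bounded_subsequence_ae _ _ _ Q (fun n c => `|balance nbrs (Kn n) n%:R x c|%N +
    n * late nbrs (Kn n) n%:R x c)%N (2 * mean + 2)) => //.
    move=> n; apply: measurable_stock; first exact: (measurable_balance_fun _ (fun z => `|z|%N)).
    exact: (measurable_fun_discrete (fun i => n * i)%N (measurable_late _ _ _ _)).
  move=> n; rewrite natexpD; last 2 first.
  + exact: (measurable_balance_fun _ (fun z => `|z|%N)).
  + exact: (measurable_fun_discrete (fun i => n * i)%N (measurable_late _ _ _ _)).
  rewrite natexpM; last exact: measurable_late.
  have := bal n x 0; rewrite absz0 addr0.
  under [X in natexp Q X]eq_fun do rewrite subr0.
  have -> : 2 * mean + 2 = (2 * mean + 1) + 1 by lra.
  rewrite [in X in _ -> X]EFinD => h; apply: leeD => //.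
  apply: le_trans (lee_wpmul2l _ (natexp_late degD Qlaw (Kn n) x (ler0n R n))) _.
    by rewrite lee_fin.
  rewrite -EFinM lee_fin; apply: le_trans (small n).
  have [nK _] := hKn n.
  have Z0 : 0 <= D%:R * early_prob (n%:R : R) ^+ (Kn n).+1.
    by rewrite mulr_ge0// exprn_ge0// early_prob_ge0.
  have : n%:R * (D%:R * early_prob (n%:R : R) ^+ (Kn n).+1) <=
      (Kn n)%:R * (D%:R * early_prob (n%:R : R) ^+ (Kn n).+1) by rewrite ler_wpM2r// ler_nat.
  have : 0 <= (Kn n)%:R * (D%:R * early_prob (n%:R : R) ^+ (Kn n).+1) by rewrite mulr_ge0.
  lra.
- apply: ae_forall_countable => m.
  have s0 := @split_prob_gt0 R D D_gt1.
  apply: (@bounded_subsequence_ae _ _ _ Q (fun n => visits nbrs (Kn n) n%:R x m)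
    ((split_prob R D)^-1 * (2 * mean + 1 + (`|m|%N)%:R))) => //.
    by move=> n; exact: measurable_visits.
  move=> n; rewrite EFinM lee_pdivlMl//.
  have h := visits_le nbrs_simple degD Qlaw (Kn n) n%:R x m.
  by have := le_trans h (bal n x m).
Qed.
End Recurrence.

(** * Recurrence of a level and fixation *)

Lemma seq_min (T : eqType) (lt : rel T) (s : seq T) : transitive lt ->
  (forall a b, a != b -> lt a b || lt b a) -> s != [::] ->
  exists2 e, e \in s & forall e', e' \in s -> e' != e -> lt e e'.
Proof.
move=> tr tot; elim: s => [//|a [|b s] ih] _.
  by exists a; [rewrite mem_head|move=> e'; rewrite inE => ->].
have [e es he] := ih isT; have [->|ne] := eqVneq a e.
  exists e; first by rewrite mem_head.
  by move=> e'; rewrite inE => /orP[->//|]; exact: he.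
have [ae|ea] := orP (tot _ _ ne).
  exists a; first by rewrite mem_head.
  move=> e'; rewrite inE => /orP[/eqP ->|e's _]; first by rewrite eqxx.
  by have [->//|ne'] := eqVneq e' e; apply: tr ae _; exact: he.
exists e; first by rewrite inE es orbT.
by move=> e'; rewrite inE => /orP[/eqP ->//|]; exact: he.
Qed.

Section EventuallyQuiet.
Variables (R : realType) (V : countType) (nbrs : V -> seq V).
Local Notation C := (config R V).
Variables (c : C) (x : V) (Kn : nat -> nat).
Hypothesis gc : good nbrs c.
Hypothesis Kn_ge : forall n, (n <= Kn n)%N.
Hypothesis often : balanced_often nbrs Kn x c.
Hypothesis bounded : visits_bounded nbrs Kn x c.

Let archi (T : R) : exists n : nat, T <= n%:R.
Proof.
exists (Num.Def.archi_bound `|T|); apply: ltW; apply: le_lt_trans (ler_norm _) _.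
exact: archi_boundP.
Qed.

(** Pigeonhole principle on the [2B + 1] levels from [-B] to [B]. *)
Lemma level_often : exists m, forall N, exists n, [/\ (N <= n)%N,
  balance nbrs (Kn n) n%:R x c = m & late nbrs (Kn n) n%:R x c = 0%N].
Proof.
have [B hB] := often; apply: contrapT => /forallNP no.
have h m : exists N, forall n, (N <= n)%N ->
    ~ (balance nbrs (Kn n) n%:R x c = m /\ late nbrs (Kn n) n%:R x c = 0%N).
  have /existsNP[N /forallNP hN] := no m; exists N => n Nn [h1 h2].
  by apply: (hN n).
have [F hF] := choice h.
pose levels : seq int := [seq (i%:Z - B%:Z)%R | i <- iota 0 (B.*2.+1)].
(* A time so late that [late] must vanish and that every level in the list has been abandoned. *)
have [n [nN nB]] := hB (maxn B.+1 (\max_(m <- levels) F m)).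
move: nN; rewrite geq_max => /andP[Bn Fn].
have l0 : late nbrs (Kn n) n%:R x c = 0%N.
  by apply/eqP; rewrite -leqn0 leqNgt; apply/negP => lp; nia.
have lev : balance nbrs (Kn n) n%:R x c \in levels.
  apply/mapP; exists (`|(balance nbrs (Kn n) n%:R x c + B%:Z)%R|%N).
    by rewrite mem_iota; lia.
  by lia.
apply: (hF _ n _ (conj erefl l0)); apply: leq_trans Fn.
exact: leq_bigmax_seq.
Qed.

(** A firing next to [x] that finds the balance at [m]. As [balance_before] depends on the
    truncation, the value is required for all large [K] and all [t] from the firing on. *)
Definition settled m (e : V * nat) : Prop := [/\ e.1 \in nbrs x, fires nbrs c e.1 e.2 &
  exists K0, forall K t, (K0 <= K)%N -> rt c e.1 e.2 <= t -> balance_before nbrs K t x e c = m].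

Hypothesis busy : forall T : R, exists y k, [/\ y \in nbrs x, fires nbrs c y k & T < rt c y k].

(* The first firing next to x after a time at which the balance is m finds the balance at m. *)
Lemma settled_often : exists m, forall T : R, exists e, settled m e /\ T < rt c e.1 e.2.
Proof.
have [m hm] := level_often; exists m => T.
have [N TN] := archi T; have [n [Nn bal l0]] := hm N.
have [y0 [k0 [y0x f0 n0]]] := busy n%:R.
have [L hL] := rings_boundedP gc.
(* Rings up to the firing [(y0, k0)] have index below [M], so the first firing after time [n] can be
   sought in a finite list. *)
pose M := (\sum_(y <- nbrs x) L y (rt c y0 k0))%N.
have hM y k : y \in nbrs x -> (M <= k)%N -> rt c y0 k0 < rt c y k.
  move=> yx Mk; apply: hL; apply: leq_trans Mk.
  by rewrite /M (big_rem y)//= leq_addr.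
have e0M : (k0 < M)%N by rewrite ltnNge; apply/negP => /(hM _ _ y0x); rewrite ltxx.
pose cand := [seq e <- events nbrs M x | fires nbrs c e.1 e.2 && (n%:R < rt c e.1 e.2)].
have mem_cand y k : y \in nbrs x -> fires nbrs c y k -> n%:R < rt c y k -> (k < M)%N ->
    (y, k) \in cand.
  move=> yx fk nk kM; rewrite mem_filter /= fk nk /=.
  by apply/allpairsPdep; exists y, k; rewrite mem_iota.
have e0c : (y0, k0) \in cand by exact: mem_cand.
have cand0 : cand != [::] by apply: contraTneq e0c => ->.
have [e ec emin] := seq_min (@before_trans R V c) (@before_total R V c) cand0.
move: (ec); rewrite mem_filter => /andP[/andP[fe ne] /allpairsPdep[y [k [yx _ eyk]]]].
have ee0 : rt c e.1 e.2 <= rt c y0 k0.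
  have [->//|ne0] := eqVneq e (y0, k0).
  by apply: (@before_rt R V c e (y0, k0)); apply: emin => //; rewrite eq_sym.
have prior e' : e'.1 \in nbrs x -> fires nbrs c e'.1 e'.2 ->
    before c e' e = (rt c e'.1 e'.2 <= n%:R).
  move=> e'x fe'; apply/idP/idP => [be|le]; last first.
    by rewrite /before (le_lt_trans le ne).
  rewrite leNgt; apply/negP => ne'.
  have [e'M|Me'] := ltnP e'.2 M; last first.
    have := before_rt be; rewrite leNgt => /negP; apply; apply: le_lt_trans ee0 _.
    by case: e' e'x Me' {fe' be ne'} => y' k' /=; exact: hM.
  have e'c : e' \in cand by case: e' e'x fe' ne' e'M {be} => y' k' /=; exact: mem_cand.
  have [ee|ne2] := eqVneq e' e; first by move: be; rewrite ee before_irr.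
  by have := before_trans be (emin _ e'c ne2); rewrite before_irr.
exists e; split; last first.
  by apply: le_lt_trans ne; apply: (le_trans TN); rewrite ler_nat.
split=> //; first by rewrite eyk.
(* No neighbour is late, so all their rings up to time [n] have index below [Kn n], and a larger
   truncation adds nothing. *)
exists (Kn n) => K t KnK tk; rewrite -bal.
have quiet y' j : y' \in nbrs x -> (Kn n <= j)%N -> n%:R < rt c y' j.
  move=> y'x Kj; apply: lt_le_trans (rt_le gc y' Kj).
  move/eqP: l0; rewrite /late sum_nat_seq_eq0 => /allP/(_ _ y'x) /=.
  by rewrite eqb0 -ltNge.
have arr (Z : C -> V -> nat -> V) :
    arrivals_before nbrs Z K t x e c = arrivals nbrs Z (Kn n) n%:R x c.
  rewrite /arrivals_before /arrivals !sum_events big_seq [RHS]big_seq.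
  apply: eq_bigr => y' y'x.
  pose A j := fired nbrs c (y', j) n%:R && (Z c y' j == x).
  have hA j : (Kn n <= j)%N -> ~~ A j.
    by move=> /(quiet _ _ y'x) h; rewrite /A /fired /= leNgt h andbF.
  rewrite (eq_bigr (fun j : 'I_K => (A j : nat))); last first.
    move=> j _; rewrite /A /fired /=; case: (boolP (fires nbrs c y' j)) => fj; last first.
      by rewrite andbF.
    rewrite (prior (y', nat_of_ord j))//=; case: (boolP (_ <= n%:R)) => //= le.
    by rewrite (le_trans le)// (le_trans _ tk)// ltW.
  by rewrite -(cntE hA KnK) (cntE hA (leqnn _)).
by rewrite /balance_before /balance !arr.
Qed.

(** [B + 1] distinct settled firings at level [m] are all counted in [visits] once [n] is large,
    whereas [visits] is at most [B] for arbitrarily large [n]. *)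
Lemma eventually_quiet_contradiction : False.
Proof.
have [m hm] := settled_often; have [B hB] := bounded m.
(* [T] bounds the times of the firings found so far; the next one is taken after [T], hence is
   new. *)
have build L : exists s T, [/\ uniq s, size s = L &
    forall e, e \in s -> settled m e /\ rt c e.1 e.2 <= T].
  elim: L => [|L [s [T [us sL hs]]]]; first by exists [::], 0.
  have [e [se Te]] := hm T; exists (e :: s), (rt c e.1 e.2); split=> /=.
  - rewrite us andbT; apply/negP => /hs[_]; by rewrite leNgt Te.
  - by rewrite sL.
  - move=> e'; rewrite inE => /orP[/eqP ->//|/hs[se' le]]; split=> //.
    exact: le_trans le (ltW Te).
have [s [T [us sB hs]]] := build B.+1.
have [F hF] : exists F : V * nat -> nat, forall e, e \in s -> forall K t, (F e <= K)%N ->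
    rt c e.1 e.2 <= t -> balance_before nbrs K t x e c = m.
  have [e|F hF] := @choice _ _ (fun e K0 => e \in s -> forall K t, (K0 <= K)%N ->
      rt c e.1 e.2 <= t -> balance_before nbrs K t x e c = m); last by exists F.
  have [es|nes] := boolP (e \in s); last by exists 0%N.
  by have [[_ _ [K0 hK0]] _] := hs _ es; exists K0.
have [n1 Tn1] := archi T.
have [n [nN nB]] := hB (maxn n1 (\max_(e <- s) maxn (F e) e.2.+1)).
move: nN; rewrite geq_max => /andP[n1n Mn].
have eM e : e \in s -> (F e <= Kn n)%N /\ (e.2 < Kn n)%N.
  move=> es; have h := leq_trans (@leq_bigmax_seq _ s predT (fun e => maxn (F e) e.2.+1) e es isT) Mn.
  have := leq_trans h (Kn_ge n); by rewrite geq_max => /andP[].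
have sub : {subset s <= [seq e <- events nbrs (Kn n) x |
    fired nbrs c e n%:R && (balance_before nbrs (Kn n) n%:R x e c == m)]}.
  move=> e es; have [[ex fe _] eT] := hs _ es; have [FK eK] := eM _ es.
  have en : rt c e.1 e.2 <= n%:R.
    by apply: le_trans eT (le_trans Tn1 _); rewrite ler_nat.
  rewrite mem_filter /fired fe en (hF _ es) ?eqxx//=.
  by apply/allpairsPdep; exists e.1, e.2; rewrite mem_iota; split=> //; case: (e).
have := uniq_leq_size us sub; rewrite sB size_filter -sum1_count big_mkcond /=.
rewrite (eq_bigr (fun e => (fired nbrs c e n%:R && (balance_before nbrs (Kn n) n%:R x e c == m) : nat))).
  by rewrite -/(visits nbrs (Kn n) n%:R x m c) ltnNge nB.
by move=> e _; case: (_ && _).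
Qed.
End EventuallyQuiet.

(** * Transfer from the given probability space to the configuration space *)

Section Transfer.
Variables (R : realType) (V : countType) (nbrs : V -> seq V) (nu : nat -> R).
Variables (d : measure_display) (Omega : measurableType d) (P : probability Omega R).
Variables (Oil Wat : V -> Omega -> nat) (E : V -> nat -> Omega -> R)
  (ZO ZW : V -> nat -> Omega -> V).
Hypothesis mOil : forall x (B : set nat), measurable (Oil x @^-1` B).
Hypothesis mWat : forall x (B : set nat), measurable (Wat x @^-1` B).
Hypothesis mE : forall x k, measurable_fun setT (E x k).
Hypothesis mZO : forall x k (B : set V), measurable (ZO x k @^-1` B).
Hypothesis mZW : forall x k (B : set V), measurable (ZW x k @^-1` B).
Hypothesis pOil : forall x n, P (Oil x @^-1` [set n]) = (nu n)%:E.
Hypothesis pWat : forall x n, P (Wat x @^-1` [set n]) = (nu n)%:E.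
Hypothesis pE : forall x k r, 0 <= r -> P [set w | E x k w <= r] = (1 - expR (- r))%:E.
Hypothesis pZO : forall x k y, P (ZO x k @^-1` [set y]) =
  (if y \in nbrs x then (size (nbrs x))%:R^-1 else 0)%:E.
Hypothesis pZW : forall x k y, P (ZW x k @^-1` [set y]) =
  (if y \in nbrs x then (size (nbrs x))%:R^-1 else 0)%:E.
Hypothesis indep : mutually_independent P (generated_events Oil Wat E ZO ZW).

Definition sample (w : Omega) : config R V :=
  Config (Oil^~ w) (Wat^~ w) (fun x k => E x k w) (fun x k => ZO x k w) (fun x k => ZW x k w).

Let mEle x k r : measurable [set w | E x k w <= r].
Proof. by apply: measurable_set_bool; apply: measurable_fun_ler. Qed.

Lemma generated_sample i A : gen i A -> generated_events Oil Wat E ZO ZW i (sample @^-1` A).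
Proof.
case=> [->|->|].
- rewrite preimage_set0; case: i => [[[[x|x]|[x k]]|[x k]]|[x k]];
    by exists set0 => //=; rewrite preimage_set0.
- rewrite preimage_setT; case: i => [[[[x|x]|[x k]]|[x k]]|[x k]];
    by exists setT => //=; rewrite preimage_setT.
case: i => [[[[x|x]|[x k]]|[x k]]|[x k]] /= [a _ <-].
- by exists [set a].
- by exists [set a].
- by exists `]-oo, a]%classic => //=; rewrite set_itvE.
- by exists [set a].
- by exists [set a].
Qed.

Lemma measurable_sample : measurable_fun setT sample.
Proof.
apply: measurable_config; case=> [[[[x|x]|[x k]]|[x k]]|[x k]] A /= [a _ <-].
- exact: (mOil x [set a]).
- exact: (mWat x [set a]).
- exact: mEle.
- exact: (mZO x k [set a]).
- exact: (mZW x k [set a]).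
Qed.

Definition sample_mfun : {mfun Omega >-> config R V} :=
  HB.pack sample (isMeasurableFun.Build _ _ _ _ _ measurable_sample).

Lemma sample_law : oil_water_law nbrs nu (distribution P sample_mfun).
Proof.
split.
- move=> s us F hF.
  change (P (sample @^-1` (\bigcap_(i in [set j | j \in s]) F i)) =
    \prod_(i <- s) P (sample @^-1` F i))%E.
  rewrite preimage_bigcap (indep us)//.
  by move=> i _; exact: generated_sample.
- by move=> x n; change (P (Oil x @^-1` [set n]) = (nu n)%:E).
- by move=> x n; change (P (Wat x @^-1` [set n]) = (nu n)%:E).
- move=> x k r; change (P [set w | E x k w <= r] = (if 0 <= r then 1 - expR (- r) else 0)%:E).
  have [r0|r0] := leP 0 r; first exact: pE.
  (* For negative [r] the event is contained in that of [r = 0], which is null by [pE]. *)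
  apply/eqP; rewrite eq_le measure_ge0 andbT.
  apply: (@le_trans _ _ (P [set w | (E x k w <= 0)%R])); last by rewrite pE// oppr0 expR0 subrr.
  apply: le_measure; rewrite ?inE//.
  by move=> w /= h; apply: le_trans h (ltW r0).
- by move=> x k y; exact: (pZO x k y).
- by move=> x k y; exact: (pZW x k y).
Qed.
End Transfer.

(** In degree at most 1, a vertex and its neighbours form a set closed under adjacency, which by
    connectedness is the whole graph. *)
Lemma degree_gt1 (V : countType) (nbrs : V -> seq V) D :
  simple_graph nbrs -> connected_graph nbrs -> infinite_vertex_set V ->
  (forall x, size (nbrs x) = D) -> (1 < D)%N.
Proof.
move=> [_ [sym _]] conn inf degD; rewrite ltnNge; apply/negP => D1; apply: inf.
have [[x _]|noV] := pselect (exists x : V, True); last first.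
  rewrite (_ : [set: V] = set0)//; apply/seteqP; split=> // x _; apply: noV; by exists x.
have closed y z : y \in x :: nbrs x -> z \in nbrs y -> z \in x :: nbrs x.
  rewrite inE => /orP[/eqP ->|yx] zy; first by rewrite inE zy orbT.
  have xy : x \in nbrs y by rewrite sym.
  have := D1; rewrite -(degD y); case: (nbrs y) xy zy => [//|a [|//]].
  by rewrite !inE => /eqP <- /eqP ->; rewrite eqxx.
have reach y w : y \in x :: nbrs x -> path (Defs.adjacent nbrs) y w -> last y w \in x :: nbrs x.
  elim: w y => [//|z w ih] y hy /= /andP[yz]; apply: ih; exact: closed yz.
apply: (@sub_finite_set _ _ [set` x :: nbrs x]); last exact: finite_seq.
move=> y _ /=; have [w /andP[pw /eqP <-]] := conn x y.
by apply: reach pw; rewrite mem_head.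
Qed.

Lemma mean_finite (R : realType) (nu : nat -> R) : (forall n, 0 <= nu n) -> (mu_of nu < +oo)%E ->
  exists mean : R, (\sum_(n <oo) (n%:R * nu n)%:E = mean%:E)%E.
Proof.
move=> nu0; rewrite /mu_of; set m := (X in (2%:E * X)%E) => h.
have m0 : (0 <= m)%E by apply: nneseries_ge0 => n _ _; rewrite lee_fin mulr_ge0.
exists (fine m); rewrite fineK// ge0_fin_numE//.
move: h; case: m m0 => [r||] // _ h; first by rewrite ltry.
by move: h; rewrite gt0_muley ?lte_fin.
Qed.

Lemma quiet_fixates (R : realType) (V : countType) (E : V -> nat -> R) (fires : V -> nat -> bool) :
  (forall y, exists T : R, forall k, fires y k -> ring_time E y k <= T) -> fixates E fires.
Proof.
move=> quiet A /finite_seqP[s ->].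
have [T hT] := choice quiet.
exists (\sum_(y <- s) `|T y|); split; first by apply: sumr_ge0.
move=> x /= xs t tau; congr cnt; apply/funext => k.
case: (boolP (fires x k)) => fk; rewrite ?andbF// !andbT.
have le : ring_time E x k <= \sum_(y <- s) `|T y|.
  apply: (le_trans (hT _ _ fk)); apply: (le_trans (ler_norm _)).
  by rewrite (big_rem x)//= lerDl sumr_ge0.
by rewrite le (le_trans le (ltW tau)).
Qed.

Unset Implicit Arguments.

Theorem theorem1p1 (R : realType) (V : countType) (nbrs : V -> seq V)
  (nu : nat -> R)
  (d : measure_display) (Omega : measurableType d) (P : probability Omega R)
  (Oil Wat : V -> Omega -> nat) (E : V -> nat -> Omega -> R)
  (ZO ZW : V -> nat -> Omega -> V) :
  (* G: infinite, connected, vertex-transitive simple graph of finite degree *)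
  simple_graph nbrs -> connected_graph nbrs -> infinite_vertex_set V ->
  vertex_transitive nbrs ->
  (* nu: probability on N with mu(nu) < oo *)
  is_prob_on_nat nu -> (mu_of nu < +oo)%E ->
  (* measurability of the primitive random variables *)
  (forall x (B : set nat), measurable (Oil x @^-1` B)) ->
  (forall x (B : set nat), measurable (Wat x @^-1` B)) ->
  (forall x k, measurable_fun setT (E x k)) ->
  (forall x k (B : set V), measurable (ZO x k @^-1` B)) ->
  (forall x k (B : set V), measurable (ZW x k @^-1` B)) ->
  (* laws: initial oils and waters ~ nu *)
  (forall x n, P (Oil x @^-1` [set n]) = (nu n)%:E) ->
  (forall x n, P (Wat x @^-1` [set n]) = (nu n)%:E) ->
  (* interarrival times of the rate-1 Poisson clocks ~ Exp(1) *)
  (forall x k r, 0 <= r -> P [set w | E x k w <= r] = (1 - expR (- r))%:E) ->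
  (* jump targets: uniform neighbours *)
  (forall x k y, P (ZO x k @^-1` [set y]) =
      (if y \in nbrs x then (size (nbrs x))%:R^-1 else 0)%:E) ->
  (forall x k y, P (ZW x k @^-1` [set y]) =
      (if y \in nbrs x then (size (nbrs x))%:R^-1 else 0)%:E) ->
  (* all of them mutually independent *)
  mutually_independent P (generated_events Oil Wat E ZO ZW) ->
  (* conclusion: almost surely the dynamics is well defined and fixates *)
  exists A : set Omega, measurable A /\ P A = 1%E /\
    forall w, A w ->
      (exists fires, consistent_traj nbrs (Oil^~ w) (Wat^~ w)
                        (fun x k => E x k w) (fun x k => ZO x k w)
                        (fun x k => ZW x k w) fires) /\
      (forall fires, consistent_traj nbrs (Oil^~ w) (Wat^~ w)
                        (fun x k => E x k w) (fun x k => ZO x k w)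
                        (fun x k => ZW x k w) fires ->
         fixates (fun x k => E x k w) fires).
Proof.
move=> simple conn inf trans [nu0 _] mu_fin mOil mWat mE mZO mZW pOil pWat pE pZO pZW indep.
have law := sample_law mOil mWat mE mZO mZW pOil pWat pE pZO pZW indep.
move: law; set Q := (X in oil_water_law _ _ X) => law.
have [un [sym _]] := simple.
have [[x0 _]|noV] := pselect (exists x0 : V, True); last first.
  exfalso; apply: inf; rewrite (_ : [set: V] = set0)//.
  by apply/seteqP; split=> // x _; apply: noV; exists x.
have degD x : size (nbrs x) = size (nbrs x0) by exact: degree_const.
have D1 := degree_gt1 simple conn inf degD.
have gd : \forall c \ae Q, good nbrs c.
  apply: filterS3 (ae_clk_pos law) (ae_locally_finite law) (precedes_wf_ae un trans law degD).
  by move=> c.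
have [mean hmean] := mean_finite nu0 mu_fin.
have mean_le (f : config R V -> nat) : measurable_fun setT f ->
    (forall n, Q [set c | f c = n] = (nu n)%:E) -> (natexp Q f <= mean%:E)%E.
  move=> mf hf; apply: (le_trans (natexp_le_series Q mf)); rewrite -hmean.
  apply: lee_nneseries => n _ /=; first by rewrite mule_ge0// measure_ge0.
  by have /= -> := hf n; rewrite EFinM.
have mean_oil x : (natexp Q (fun c => oil c x) <= mean%:E)%E.
  by apply: mean_le; [exact: measurable_oil|exact: law_oil law x].
have mean_wat x : (natexp Q (fun c => wat c x) <= mean%:E)%E.
  by apply: mean_le; [exact: measurable_wat|exact: law_wat law x].
have [Kn [Kn_ge rec]] := recurrence_ae simple trans degD D1 law gd mean_oil mean_wat.
have [N [mN N0 hN]] := filterI gd (ae_forall_countable rec).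
exists (sample Oil Wat E ZO ZW @^-1` (~` N)); split; [|split].
- rewrite -[X in measurable X]setTI; apply: measurable_sample => //.
  exact: measurableC.
- change (Q (~` N) = 1%E).
  by rewrite probability_setC// N0 sube0.
move=> w Nw.
have [gw recw] : good nbrs (sample Oil Wat E ZO ZW w) /\
    forall x, balanced_often nbrs Kn x (sample Oil Wat E ZO ZW w) /\
      visits_bounded nbrs Kn x (sample Oil Wat E ZO ZW w).
  by apply: contrapT => h; apply: Nw; apply: hN.
split; first by exists (fires nbrs (sample Oil Wat E ZO ZW w)); exact: fires_consistent.
move=> f /(consistent_unique gw) ->.
apply: quiet_fixates => y.
have : (0 < size (nbrs y))%N by rewrite degD ltnW.
(* The contradiction concerns firings next to a site, so it is applied at a neighbour [x] of [y]:
   endless firing at [y] keeps the surroundings of [x] busy. *)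
case nE : (nbrs y) => [//|x r] _.
have yx : y \in nbrs x by rewrite -sym nE mem_head.
have [oft bnd] := recw x.
apply: contrapT => /forallNP busy.
apply: (eventually_quiet_contradiction gw Kn_ge oft bnd) => T.
have /existsNP[k /not_implyP[fk /negP]] := busy T.
by rewrite -ltNge => Tk; exists y, k.
Qed.
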